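(* Let $Z,W,A_\star,B_\star$, the data points $\{u(t_i),x(t_i),\dot x(t_i)\}_{i=0}^{T-1}$, $\delta>0$, and $\hat Z,H$ be as in the context (in particular, the data satisfy $\dot x(t_i)=A_\star Z(x(t_i))+B_\star W(x(t_i))u(t_i)+d(t_i)$ with $|d(t_i)|^2\le\delta$ for all $i$, and $Z=H\hat Z$). Let the optimization program (OPT) in the context be feasible, let $\bar{\mathbf A},\bar{\mathbf B}$ be a solution of it, and let $\bar{\boldsymbol\zeta}:=-\bar{\mathbf A}^{-1}\bar{\mathbf B}$, $\bar{\mathbf Q}:=I_n$ and $\bar{\mathcal I}$ be the corresponding objects defined in the context. For a given symmetric polynomial matrix $\Xi:\mathbb R^n\to\mathbb R^{\hat N\times\hat N}$ and a given scalar $\varepsilon>0$, suppose there exist a matrix $P=P^\top\succ0$ in $\mathbb R^{\hat N\times\hat N}$, polynomial matrices $Y:\mathbb R^n\to\mathbb R^{m\times\hat N}$ and $\Gamma:\mathbb R\to\mathbb R^{n\times n}$, a symmetric polynomial matrix $\Theta:\mathbb R^n\to\mathbb R^{\hat N\times\hat N}$, a scalar $\eta>0$, a polynomial $\lambda$ in $(x,d)\in\mathbb R^n\times\mathbb R^n$, an SOS polynomial $s_\lambda$ in $(x,d)$, and SOS polynomial matrices $S_\Theta$ (in $x$) and $S_\partial$ (in $(x,d)$) such that for all $r\in\mathbb R$, $x\in\mathbb R^n$ and $d\in\mathbb R^n$: (a) $\Gamma(r)=\sum_{j=0}^{\nu}C_jr^{2j}$ for some integer $\nu\ge0$ and matrices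 $C_0=C_0^\top\succeq0,\dots,C_\nu=C_\nu^\top\succeq0$ with $\sum_{j=0}^{\nu}C_j\succeq\varepsilon I$; (b) $\lambda(x,d)-\varepsilon=s_\lambda(x,d)$; (c) $\Theta(x)-\eta\,\Xi(x)=S_\Theta(x)$; (d) with $L(x):=\begin{bmatrix}H(x)P\\ W(x)Y(x)\end{bmatrix}$ and $J(x):=\frac{\partial\hat Z(x)}{\partial x}\in\mathbb R^{\hat N\times n}$, $$\begin{bmatrix}\mathrm{Tp}\big(L(x)^\top\bar{\boldsymbol\zeta}J(x)^\top\big)+\Theta(x)+\lambda(x,d)J(x)\bar{\mathbf Q}J(x)^\top&J(x)&L(x)^\top\\ J(x)^\top&-\Gamma(|d|)&0\\ L(x)&0&-\lambda(x,d)\bar{\mathbf A}\end{bmatrix}=-S_\partial(x,d).$$ Then, if the function $b(x):=\hat Z(x)^\top P^{-1}\Xi(x)P^{-1}\hat Z(x)$ is positive definite and radially unbounded, the closed-loop system $$\dot x=[A\ \,B]\begin{bmatrix}H(x)\hat Z(x)\\ W(x)Y(x)P^{-1}\hat Z(x)\end{bmatrix}+d$$ is input-to-state stable (ISS) with respect to the process disturbance $d\in\mathbb R^n$ for all $[A\ \,B]\in\bar{\mathcal I}$, and in particular for $[A_\star\ \,B_\star]$.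
   Context: System and libraries. $x\in\mathbb R^n$ is the state and $u\in\mathbb R^m$ the input. $Z:\mathbb R^n\to\mathbb R^N$ and $W:\mathbb R^n\to\mathbb R^{M\times m}$ are known function libraries whose elements are monomials of $x$, with $Z(0)=0$. The actual system is $\dot x=A_\star Z(x)+B_\star W(x)u$ for (unknown) constant matrices $A_\star\in\mathbb R^{n\times N}$, $B_\star\in\mathbb R^{n\times M}$. Reduced library. $\hat Z:\mathbb R^n\to\mathbb R^{\hat N}$ is a polynomial vector and $H:\mathbb R^n\to\mathbb R^{N\times\hat N}$ a polynomial matrix such that $\hat Z(x)=0$ if and only if $x=0$, $Z(x)=H(x)\hat Z(x)$ for all $x$, and $|\hat Z(x)|\to\infty$ as $|x|\to\infty$. Data. There are $T$ data points $(u(t_i),x(t_i),\dot x(t_i))\in\mathbb R^m\times\mathbb R^n\times\mathbb R^n$, $i=0,\dots,T-1$, satisfying $\dot x(t_i)=A_\star Z(x(t_i))+B_\star W(x(t_i))u(t_i)+d(t_i)$ for some noise samples with $|d(t_i)|^2\le\delta$, where $\delta>0$ is known. (The disturbance $d$ in the claim's closed-loop system is an arbitrary exogenous input, not restricted by $\delta$.) Optimization program. Let $\ell_i:=\begin{bmatrix}Z(x(t_i))\\ W(x(t_i))u(t_i)\end{bmatrix}$, $\boldsymbol C_i:=\dot x(t_i)\dot x(t_i)^\top-\delta I$, $\boldsymbol B_i:=-\ell_i\dot x(t_i)^\top$, $\boldsymbol A_i:=\ell_i\ell_i^\top$. The program (OPT) is: minimize $-\log\det\bar{\mathbf A}$ over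 symmetric $\bar{\mathbf A}\in\mathbb R^{(N+M)\times(N+M)}$, $\bar{\mathbf B}\in\mathbb R^{(N+M)\times n}$ and scalars $\tau_0,\dots,\tau_{T-1}$, subject to $\bar{\mathbf A}\succ0$, $\tau_0\ge0,\dots,\tau_{T-1}\ge0$ and $$\begin{bmatrix}-I-\sum_{i}\tau_i\boldsymbol C_i&\star&\star\\ \bar{\mathbf B}-\sum_i\tau_i\boldsymbol B_i&\bar{\mathbf A}-\sum_i\tau_i\boldsymbol A_i&\star\\ \bar{\mathbf B}&0&-\bar{\mathbf A}\end{bmatrix}\preceq0.$$ The set $\bar{\mathcal I}$. For a solution $\bar{\mathbf A},\bar{\mathbf B}$ of (OPT), $$\bar{\mathcal I}:=\{[A\ \,B]=\zeta^\top:\ \bar{\mathbf B}^\top\bar{\mathbf A}^{-1}\bar{\mathbf B}+\bar{\mathbf B}^\top\zeta+\zeta^\top\bar{\mathbf B}+\zeta^\top\bar{\mathbf A}\zeta\preceq I\},$$ with $A\in\mathbb R^{n\times N}$, $B\in\mathbb R^{n\times M}$. Equivalently, $\bar{\mathcal I}=\{(\bar{\boldsymbol\zeta}+\bar{\mathbf A}^{-1/2}\Upsilon\bar{\mathbf Q}^{1/2})^\top:\|\Upsilon\|\le1\}$ with $\|\cdot\|$ the induced 2-norm. Notation. $|\cdot|$ is the Euclidean norm; $\succ,\succeq,\preceq$ refer to the semidefinite order on symmetric matrices; $\mathrm{Tp}(A):=A+A^\top$; $\star$ denotes the blocks making a matrix symmetric; $\frac{\partial\hat Z}{\partial x}$ is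 the Jacobian matrix. A function $f:\mathbb R^n\to\mathbb R$ is positive definite if $f(0)=0$ and $f(x)>0$ for $x\ne0$, and radially unbounded if $f(x)\to\infty$ as $|x|\to\infty$. A polynomial is SOS if it is a sum of squares of polynomials; a symmetric polynomial matrix $S$ is SOS if $S=R^\top R$ for some polynomial matrix $R$. ISS. A continuous $\gamma:[0,\infty)\to[0,\infty)$ is of class $\mathcal K$ if it is strictly increasing and $\gamma(0)=0$. A continuous $\beta:[0,\infty)\times[0,\infty)\to[0,\infty)$ is of class $\mathcal{KL}$ if $\beta(\cdot,s)$ is of class $\mathcal K$ for each fixed $s$ and, for each fixed $r$, $\beta(r,\cdot)$ is decreasing with $\lim_{s\to\infty}\beta(r,s)=0$. A system $\dot x=F(x,v)$, $F(0,0)=0$, $F$ locally Lipschitz, with input $v\in\mathbb R^p$, is ISS with respect to $v$ if there exist $\beta$ of class $\mathcal{KL}$ and $\gamma$ of class $\mathcal K$ such that for each $x^\circ\in\mathbb R^n$ and each piecewise continuous bounded $v:[0,\infty)\to\mathbb R^p$, the solution with $x(0)=x^\circ$ satisfies $|x(t)|\le\beta(|x^\circ|,t)+\gamma(\sup_{s\ge0}|v(s)|)$ for all $t\ge0$. *)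

(* Defs.v *)
From HB Require Import structures.
From mathcomp Require Import all_boot all_order all_algebra.
From mathcomp Require Import all_classical all_reals all_analysis.
From mathcomp Require mpoly.
Import (canonicals) mpoly.

Set Implicit Arguments.
Unset Strict Implicit.
Unset Printing Implicit Defensive.

Import Order.TTheory GRing.Theory Num.Theory.
Import numFieldNormedType.Exports.

Local Open Scope classical_set_scope.
Local Open Scope ring_scope.

(* mpoly is not imported: its notations clash with those of mathcomp-analysis. *)
Notation mpolynomial R n := (mpoly.mpoly n R).

Section Matrices.
Context {R : realType}.

(* The library norm [`|v|] on matrices is the max norm. *)
Definition enorm {k : nat} (v : 'cV[R]_k) : R :=
  Num.sqrt (\sum_(i < k) v i ord0 ^+ 2).

Definition qform {k : nat} (A : 'M[R]_k) (v : 'cV[R]_k) : R :=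
  (v^T *m A *m v) ord0 ord0.

Definition posdef {k : nat} (A : 'M[R]_k) : Prop :=
  A^T = A /\ forall v : 'cV[R]_k, v != 0 -> 0 < qform A v.

Definition possemidef {k : nat} (A : 'M[R]_k) : Prop :=
  A^T = A /\ forall v : 'cV[R]_k, 0 <= qform A v.

(* The semidefinite order: [loewner A B] is A ⪯ B. *)
Definition loewner {k : nat} (A B : 'M[R]_k) : Prop := possemidef (B - A).

Definition Tp {k : nat} (A : 'M[R]_k) : 'M[R]_k := A + A^T.

(* The symmetric 3 x 3 block matrix with the given lower-triangular blocks. *)
Definition sym_block3 {p q r : nat} (A11 : 'M[R]_p)
    (A21 : 'M[R]_(q, p)) (A22 : 'M[R]_q)
    (A31 : 'M[R]_(r, p)) (A32 : 'M[R]_(r, q)) (A33 : 'M[R]_r) :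
    'M[R]_(p + q + r) :=
  block_mx (block_mx A11 A21^T A21 A22) (col_mx A31^T A32^T)
           (row_mx A31 A32) A33.

Definition positive_definite {k : nat} (f : 'cV[R]_k -> R) : Prop :=
  f 0 = 0 /\ forall x, x != 0 -> 0 < f x.

Definition radially_unbounded {k : nat} (f : 'cV[R]_k -> R) : Prop :=
  forall K : R, exists r : R, forall x, r < enorm x -> K < f x.

End Matrices.

Section Polynomials.
Context {R : realType}.

Definition peval {k : nat} (p : mpolynomial R k) (x : 'cV[R]_k) : R :=
  mpoly.meval (fun i => x i ord0) p.

Definition pmeval {k p q : nat} (S : 'M[mpolynomial R k]_(p, q))
    (x : 'cV[R]_k) : 'M[R]_(p, q) := map_mx (peval^~ x) S.

(* The coefficient is arbitrary; in particular zero entries are allowed. *)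
Definition is_monomial {k : nat} (p : mpolynomial R k) : Prop :=
  exists (c : R) (a : mpoly.multinom k), p = c *: mpoly.mpolyX R a.

Definition sos {k : nat} (p : mpolynomial R k) : Prop :=
  exists s : seq (mpolynomial R k), p = \sum_(q <- s) q ^+ 2.

Definition sos_mx {k p : nat} (S : 'M[mpolynomial R k]_p) : Prop :=
  exists (q : nat) (Q : 'M[mpolynomial R k]_(q, p)), S = Q^T *m Q.

(* The library's jacobian acts on row vectors and is transposed. *)
Definition jacobian_mx {k p : nat} (f : 'cV[R]_k -> 'cV[R]_p) (x : 'cV[R]_k) :
    'M[R]_(p, k) :=
  \matrix_(i, j) 'D_(delta_mx j ord0) (fun y => f y i ord0) x.

End Polynomials.

Section ISS.
Context {R : realType}.

Definition class_K (g : R -> R) : Prop :=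
  [/\ {within `[0, +oo[, continuous g},
      {in `[0, +oo[ &, {homo g : r s / r < s}}
    & g 0 = 0].

(* "Decreasing" is non-strict: beta 0 s = 0 for all s. *)
Definition class_KL (beta : R -> R -> R) : Prop :=
  [/\ {within `[0, +oo[ `*` `[0, +oo[,
         continuous (fun z : R * R => beta z.1 z.2)},
      forall s : R, 0 <= s -> class_K (beta^~ s),
      forall r : R, 0 <= r -> {in `[0, +oo[ &, {homo beta r : s t / s <= t >-> t <= s}}
    & forall r : R, 0 <= r -> beta r s @[s --> +oo] --> (0 : R)].

(* Only the values of [v] on [0, +oo[ matter. *)
Definition piecewise_continuous {p : nat} (v : R -> 'cV[R]_p) : Prop :=
  [/\ forall T : R, exists s : seq R,
        forall t : R, 0 < t -> t < T -> t \notin s -> {for t, continuous v},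
      forall t : R, 0 <= t -> cvg (v @ t^'+)
    & forall t : R, 0 < t -> cvg (v @ t^'-)].

Definition bounded_input {p : nat} (v : R -> 'cV[R]_p) : Prop :=
  exists M : R, forall t : R, 0 <= t -> enorm (v t) <= M.

Definition is_solution {n p : nat} (F : 'cV[R]_n -> 'cV[R]_p -> 'cV[R]_n)
    (v : R -> 'cV[R]_p) (x0 : 'cV[R]_n) (x : R -> 'cV[R]_n) : Prop :=
  [/\ x 0 = x0,
      {within `[0, +oo[, continuous x}
    & forall t : R, 0 < t -> {for t, continuous v} ->
        is_derive t (1 : R) x (F (x t) (v t))].

(* Independent of the choice of norms. *)
Definition locally_lipschitz {n p : nat}
    (F : 'cV[R]_n -> 'cV[R]_p -> 'cV[R]_n) : Prop :=
  forall z : 'cV[R]_n * 'cV[R]_p,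
    exists2 U, nbhs z U & [lipschitz F y.1 y.2 | y in U].

Definition ISS {n p : nat} (F : 'cV[R]_n -> 'cV[R]_p -> 'cV[R]_n) : Prop :=
  [/\ F 0 0 = 0,
      locally_lipschitz F
    & exists (beta : R -> R -> R) (gamma : R -> R),
      [/\ class_KL beta, class_K gamma
        & forall (x0 : 'cV[R]_n) (v : R -> 'cV[R]_p),
          piecewise_continuous v -> bounded_input v ->
          (exists x, is_solution F v x0 x) /\
          forall x, is_solution F v x0 x -> forall t : R, 0 <= t ->
            enorm (x t) <= beta (enorm x0) t
              + gamma (sup [set enorm (v s) | s in [set s | 0 <= s]])]].

End ISS.

Section DataProgram.
Context {R : realType}.

Section Fixed.
Context {n m N M T : nat}.
Variables (Z : 'cV[mpolynomial R n]_N) (W : 'M[mpolynomial R n]_(M, m)).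
Variables (u : 'I_T -> 'cV[R]_m) (x xdot : 'I_T -> 'cV[R]_n) (delta : R).

Definition data_ell (i : 'I_T) : 'cV[R]_(N + M) :=
  col_mx (pmeval Z (x i)) (pmeval W (x i) *m u i).

Definition data_C (i : 'I_T) : 'M[R]_n := xdot i *m (xdot i)^T - delta%:M.
Definition data_B (i : 'I_T) : 'M[R]_(N + M, n) := - (data_ell i *m (xdot i)^T).
Definition data_A (i : 'I_T) : 'M[R]_(N + M) := data_ell i *m (data_ell i)^T.

Definition opt_constraints (A : 'M[R]_(N + M)) (B : 'M[R]_(N + M, n))
    (tau : 'I_T -> R) : Prop :=
  [/\ posdef A,
      forall i, 0 <= tau i
    & loewner
        (sym_block3
          (- 1%:M - \sum_i tau i *: data_C i)
          (B - \sum_i tau i *: data_B i) (A - \sum_i tau i *: data_A i)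
          B                              0                              (- A))
        0].

Definition opt_feasible : Prop :=
  exists A B tau, opt_constraints A B tau.

Definition opt_solution (A : 'M[R]_(N + M)) (B : 'M[R]_(N + M, n))
    (tau : 'I_T -> R) : Prop :=
  opt_constraints A B tau /\
  forall A' B' tau', opt_constraints A' B' tau' ->
    - ln (\det A) <= - ln (\det A').

End Fixed.

Definition Ibar {n N M : nat} (Abar : 'M[R]_(N + M)) (Bbar : 'M[R]_(N + M, n))
    (A : 'M[R]_(n, N)) (B : 'M[R]_(n, M)) : Prop :=
  let zeta := (row_mx A B)^T in
  loewner (Bbar^T *m invmx Abar *m Bbar + Bbar^T *m zeta + zeta^T *m Bbar
           + zeta^T *m Abar *m zeta)
          1%:M.

End DataProgram.

Definition closed_loop {R : realType} {n m N M hN : nat}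
    (W : 'M[mpolynomial R n]_(M, m)) (hZ : 'cV[mpolynomial R n]_hN)
    (H : 'M[mpolynomial R n]_(N, hN)) (Y : 'M[mpolynomial R n]_(m, hN))
    (P : 'M[R]_hN) (A : 'M[R]_(n, N)) (B : 'M[R]_(n, M))
    (x d : 'cV[R]_n) : 'cV[R]_n :=
  row_mx A B *m
    col_mx (pmeval H x *m pmeval hZ x)
           (pmeval W x *m pmeval Y x *m invmx P *m pmeval hZ x)
  + d.

(* Main.v *)
(* With [V x = hZ(x)^T P^-1 hZ(x)], testing the matrix of (d) at a suitable vector gives
   [V' <= - eta b(x) + d^T Gamma(|d|) d] along the closed loop for every [A B] in
   [Ibar]; testing the constraint of (OPT) shows that [Astar Bstar] lies in [Ibar].
   By compactness [V <= kappa (eta b)] and [d^T Gamma(|d|) d <= sigma |d|] for some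
   class K functions, so that [V' <= - s] as long as
   [V > kappa (2 max (s, sigma (sup |d|)))].  Comparison up to time [t] with
   [s = V(x0) / (1 + t)] gives
   [V(x(t)) <= kappa (2 s) + s + kappa (2 sigma (sup |d|))], an explicit ISS estimate.
   Solutions exist globally by Picard iteration for the vector field precomposed with
   a saturation, which the same Lyapunov estimate keeps inactive. *)

Require Import Defs.
From HB Require Import structures.
From mathcomp Require Import all_boot all_order all_algebra.
From mathcomp Require Import all_classical all_reals all_analysis.
From mathcomp Require mpoly.
From mathcomp Require Import ring lra.
Import (canonicals) mpoly.

Set Implicit Arguments.
Unset Strict Implicit.
Unset Printing Implicit Defensive.

Import Order.TTheory GRing.Theory Num.Theory.
Import numFieldNormedType.Exports.

Local Open Scope classical_set_scope.
Local Open Scope ring_scope.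

(** * Bilinear forms, and the two matrix inequalities tested at vectors *)

Section LinearAlgebra.
Context {R : realType}.

(** Every comparison is an upper bound: [V] by [eta b], [d^T Gamma(|d|) d] by the norm of [d], the
    norm of [x] by [V], and [V] by the norm. No class K function is ever inverted, and one
    domination lemma supplies all four gains. The rate [s] is constant on [[0, t]] but chosen anew
    for each final time [t], so a mean value estimate replaces comparison with a scalar differential
    equation. Inputs may jump, so a trajectory is differentiable only off a set that is finite on
    bounded intervals. The mean value estimates tolerate such a set. Existence avoids it by
    subtracting an antiderivative of the input: what remains has a continuous right-hand side, and
    every Picard iterate is differentiable at all positive times. The polynomial field is Lipschitz
    only on balls, while the Lyapunov estimate concerns the true field and not the saturated one.
    This circle is broken by a barrier argument, which uses the estimate only on a strip of values
    of [V] where saturation is known to be inactive. *)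

Definition bform {k l : nat} (A : 'M[R]_(k, l)) (u : 'cV[R]_k) (v : 'cV[R]_l) : R :=
  (u^T *m A *m v) ord0 ord0.

Lemma qformE k (A : 'M[R]_k) v : qform A v = bform A v v.
Proof. by []. Qed.

Lemma bformT k l (A : 'M[R]_(k, l)) u v : bform A u v = bform A^T v u.
Proof.
rewrite /bform -[in LHS](trmxK (u^T *m A *m v)) mxE.
by rewrite !trmx_mul trmxK mulmxA.
Qed.

Lemma bformDr k l (A : 'M[R]_(k, l)) u v w : bform A u (v + w) = bform A u v + bform A u w.
Proof. by rewrite /bform mulmxDr mxE. Qed.

Lemma bformZr k l (A : 'M[R]_(k, l)) u c w : bform A u (c *: w) = c * bform A u w.
Proof. by rewrite /bform -scalemxAr mxE. Qed.

Lemma bformDl k l (A : 'M[R]_(k, l)) u v w : bform A (u + v) w = bform A u w + bform A v w.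
Proof. by rewrite bformT bformDr -!bformT. Qed.

Lemma bformZl k l (A : 'M[R]_(k, l)) u c w : bform A (c *: u) w = c * bform A u w.
Proof. by rewrite bformT bformZr -bformT. Qed.

Lemma bformDm k l (A B : 'M[R]_(k, l)) u v : bform (A + B) u v = bform A u v + bform B u v.
Proof. by rewrite /bform mulmxDr mulmxDl mxE. Qed.

Lemma bformNm k l (A : 'M[R]_(k, l)) u v : bform (- A) u v = - bform A u v.
Proof. by rewrite /bform mulmxN mulNmx mxE. Qed.

Lemma bformBm k l (A B : 'M[R]_(k, l)) u v : bform (A - B) u v = bform A u v - bform B u v.
Proof. by rewrite bformDm bformNm. Qed.

Lemma bformZm k l (A : 'M[R]_(k, l)) c u v : bform (c *: A) u v = c * bform A u v.
Proof. by rewrite /bform -scalemxAr -scalemxAl mxE. Qed.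

Lemma bform0m k l u v : bform (0 : 'M[R]_(k, l)) u v = 0.
Proof. by rewrite /bform mulmx0 mul0mx mxE. Qed.

Lemma bform_summ k l I (r : seq I) (A : I -> 'M[R]_(k, l)) u v :
  bform (\sum_(i <- r) A i) u v = \sum_(i <- r) bform (A i) u v.
Proof.
elim/big_ind2: _ => [|? ? ? ? <- <-|//]; first exact: bform0m.
exact: bformDm.
Qed.

Lemma bform_mulr k l p (A : 'M[R]_(k, l)) (B : 'M[R]_(l, p)) u v :
  bform (A *m B) u v = bform A u (B *m v).
Proof. by rewrite /bform !mulmxA. Qed.

Lemma bform_mull k l p (A : 'M[R]_(l, k)) (B : 'M[R]_(k, p)) u v :
  bform (A *m B) u v = bform B (A^T *m u) v.
Proof. by rewrite /bform trmx_mul trmxK !mulmxA. Qed.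

Lemma bform1C k (u v : 'cV[R]_k) : bform 1%:M u v = bform 1%:M v u.
Proof. by rewrite bformT trmx1. Qed.

Lemma bform_scalar k c (u v : 'cV[R]_k) : bform c%:M u v = c * bform 1%:M u v.
Proof. by rewrite -(scalemx1 _ c) bformZm. Qed.

Lemma bformE1 k l (A : 'M[R]_(k, l)) u v : bform A u v = bform 1%:M u (A *m v).
Proof. by rewrite -bform_mulr mul1mx. Qed.

Lemma bform1E k (u v : 'cV[R]_k) : bform 1%:M u v = \sum_i u i ord0 * v i ord0.
Proof. by rewrite /bform mulmx1 mxE; apply: eq_bigr => i _; rewrite mxE. Qed.

Lemma sqr_enorm k (v : 'cV[R]_k) : enorm v ^+ 2 = qform 1%:M v.
Proof.
rewrite qformE bform1E sqr_sqrtr; first by apply: eq_bigr => i _; rewrite expr2.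
by apply: sumr_ge0 => i _; exact: sqr_ge0.
Qed.

Lemma qform1_ge0 k (v : 'cV[R]_k) : 0 <= qform 1%:M v.
Proof. by rewrite -sqr_enorm sqr_ge0. Qed.

Lemma qform1_eq0 k (v : 'cV[R]_k) : qform 1%:M v = 0 -> v = 0.
Proof.
rewrite qformE bform1E => /eqP; rewrite psumr_eq0; last by move=> i _; rewrite -expr2 sqr_ge0.
move=> /allP v0; apply/matrixP => i j; rewrite ord1 mxE; apply/eqP.
by have := v0 i (mem_index_enum i); rewrite mulf_eq0 orbb.
Qed.

Lemma cauchy_schwarz k (u v : 'cV[R]_k) :
  bform 1%:M u v ^+ 2 <= bform 1%:M u u * bform 1%:M v v.
Proof.
have [/qform1_eq0 ->|v0] := eqVneq (qform 1%:M v) 0.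
  by rewrite /bform !mulmx0 !mxE mulr0 expr0n.
have vv : 0 < qform 1%:M v by rewrite lt0r v0 qform1_ge0.
rewrite -subr_ge0 -(pmulr_lge0 _ vv) qformE.
(* The square of this vector is [|v|^2 (|u|^2 |v|^2 - (u . v)^2)], hence the multiplication by
   [|v|^2] just before. *)
have := qform1_ge0 (bform 1%:M v v *: u + (- bform 1%:M u v) *: v).
rewrite qformE !(bformDl, bformDr, bformZl, bformZr) (bform1C v u).
by congr (0 <= _); ring.
Qed.

Lemma posdef_semi k (A : 'M[R]_k) : posdef A -> possemidef A.
Proof.
case=> sA pA; split=> // v; have [->|/pA/ltW//] := eqVneq v 0.
by rewrite /qform mulmx0 mxE.
Qed.

Lemma posdef_unitmx k (A : 'M[R]_k) : posdef A -> A \in unitmx.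
Proof.
case=> _ pA; rewrite -row_free_unit -kermx_eq0; apply/rowV0P => v /sub_kermxP vA.
apply/eqP; apply: contraT => v0; have := pA v^T; rewrite trmx_eq0 => /(_ v0).
by rewrite /qform trmxK vA mul0mx mxE ltxx.
Qed.

Lemma qform_sym_block3 p q r (A11 : 'M[R]_p) (A21 : 'M[R]_(q, p)) (A22 : 'M[R]_q)
    (A31 : 'M[R]_(r, p)) (A32 : 'M[R]_(r, q)) (A33 : 'M[R]_r) a b c :
  qform (sym_block3 A11 A21 A22 A31 A32 A33) (col_mx (col_mx a b) c) =
  qform A11 a + 2 * bform A21 b a + qform A22 b + 2 * bform A31 c a
  + 2 * bform A32 c b + qform A33 c.
Proof.
have addE (X Y : 'M[R]_1) : (X + Y) ord0 ord0 = X ord0 ord0 + Y ord0 ord0.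
  by rewrite mxE.
have bE k l (A : 'M[R]_(k, l)) u v : (u^T *m A *m v) ord0 ord0 = bform A u v by [].
rewrite /qform /sym_block3 !tr_col_mx !mul_row_block !mul_row_col !mul_mx_row.
rewrite add_row_mx !mul_row_col !mulmxDl !addE !bE.
rewrite -[bform A21^T _ _]bformT -[bform A31^T _ _]bformT -[bform A32^T _ _]bformT.
ring.
Qed.

(** This exhibits [Ibar] as a matrix ellipsoid: its defining expression is the weighted square of
    the deviation of [z] from the centre [- A^-1 B]. *)
Lemma completed_square k l (A : 'M[R]_k) (B z : 'M[R]_(k, l)) : posdef A ->
  B^T *m invmx A *m B + B^T *m z + z^T *m B + z^T *m A *m z
  = (z + invmx A *m B)^T *m A *m (z + invmx A *m B).
Proof.
move=> pA; have uA := posdef_unitmx pA; have sA := pA.1.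
have siA : (invmx A)^T = invmx A by rewrite trmx_inv sA.
have -> : (z + invmx A *m B)^T = z^T + B^T *m invmx A.
  by rewrite raddfD /= trmx_mul siA.
rewrite !mulmxDl !mulmxDr -![_ *m invmx A *m A]mulmxA mulVmx // mulmx1.
rewrite -[_ *m A *m (invmx A *m B)]mulmxA [A *m (_ *m B)]mulmxA mulmxV // mul1mx.
rewrite mulmxA -[LHS]addrA [RHS]addrC [z^T *m A *m z + _]addrC.
by rewrite [B^T *m z + _]addrC.
Qed.

(* Testing the block matrix at [(y, d, D J^T y)] makes the [lam]-terms cancel up
   to [lam (D^T A D - 1) <= 0], so no inverse of [lam A] is needed. *)
Lemma dissipation_inequality p n k (J : 'M[R]_(p, n)) (L : 'M[R]_(k, p))
    (zeta D : 'M[R]_(k, n)) (A : 'M[R]_k) (Th : 'M[R]_p) (G : 'M[R]_n) (lam : R) y d :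
  0 <= lam -> loewner (D^T *m A *m D) 1%:M ->
  (forall v, qform (sym_block3
      (Tp (L^T *m zeta *m J^T) + Th + lam *: (J *m 1%:M *m J^T))
      J^T (- G) L 0 (- (lam *: A))) v <= 0) ->
  2 * bform J y ((zeta + D)^T *m (L *m y) + d) <= - qform Th y + qform G d.
Proof.
move=> lam0 [_ DA] /(_ (col_mx (col_mx y d) (D *m (J^T *m y)))).
have /(mulr_ge0 lam0) := DA (J^T *m y).
rewrite qform_sym_block3 bform0m !qformE !(bformDm, bformNm, bformZm) linearD /=.
rewrite mulmxDl !bformDr mulmx1.
set a := J^T *m y; set w := L *m y.
have -> : bform J y (zeta^T *m w) = bform 1%:M w (zeta *m a).
  by rewrite -[in LHS](mulmx1 J) bform_mull -bform_mulr mul1mx bformT trmxK bformE1.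
have -> : bform J y (D^T *m w) = bform 1%:M w (D *m a).
  by rewrite -[in LHS](mulmx1 J) bform_mull -bform_mulr mul1mx bformT trmxK bformE1.
have -> : bform (L^T *m zeta *m J^T) y y = bform 1%:M w (zeta *m a).
  by rewrite -mulmxA bform_mull trmxK bformE1 -[zeta *m J^T *m y]mulmxA.
have -> : bform (L^T *m zeta *m J^T)^T y y = bform 1%:M w (zeta *m a).
  by rewrite -bformT -mulmxA bform_mull trmxK bformE1 -[zeta *m J^T *m y]mulmxA.
have -> : bform L (D *m a) y = bform 1%:M w (D *m a).
  by rewrite bformE1 bform1C.
have -> : bform J^T d y = bform J y d by rewrite bformT trmxK.
have -> : bform (J *m J^T) y y = bform 1%:M a a by rewrite bform_mull bformE1.
have -> : bform (D^T *m A *m D) a a = bform A (D *m a) (D *m a).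
  by rewrite -[_ *m A *m _]mulmxA bform_mull trmxK bform_mulr.
lra.
Qed.

(* Each data point contributes [d_i d_i^T - delta I <= 0], tested at [w]. *)
Lemma data_consistent n N M T (l : 'I_T -> 'cV[R]_(N + M)) (xdot d : 'I_T -> 'cV[R]_n)
    (z : 'M[R]_(N + M, n)) (delta : R) (tau : 'I_T -> R) A (B : 'M[R]_(N + M, n)) :
  (forall i, xdot i = z^T *m l i + d i) ->
  (forall i, enorm (d i) ^+ 2 <= delta) ->
  (forall i, 0 <= tau i) -> posdef A ->
  (forall v, qform (sym_block3
     (- 1%:M - \sum_i tau i *: (xdot i *m (xdot i)^T - delta%:M))
     (B - \sum_i tau i *: - (l i *m (xdot i)^T)) (A - \sum_i tau i *: (l i *m (l i)^T))
     B 0 (- A)) v <= 0) ->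
  loewner (B^T *m invmx A *m B + B^T *m z + z^T *m B + z^T *m A *m z) 1%:M.
Proof.
move=> xdotE d_le tau0 pA LMI.
have sA := pA.1; have uA := posdef_unitmx pA.
split=> [|w].
  rewrite completed_square //; set X := z + _.
  by rewrite raddfB /= trmx1 !trmx_mul trmxK sA mulmxA.
(* The third block [c = A^-1 B w] maximises [2 c^T B w - c^T A c], with value [w^T B^T A^-1 B w];
   this replaces a Schur complement. The middle block [z w] pairs with [l_i] to
   [(xdot_i - d_i) . w]. *)
have := LMI (col_mx (col_mx w (z *m w)) (invmx A *m B *m w)).
rewrite qform_sym_block3 !qformE bform0m !(bformDm, bformNm, bform_summ).
have H1 : bform (B^T *m invmx A *m B) w w = bform 1%:M (B *m w) (invmx A *m (B *m w)).
  by rewrite -[B^T *m _ *m _]mulmxA bform_mull trmxK bform_mulr bformE1.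
rewrite H1.
have -> : bform (B^T *m z) w w = bform 1%:M (B *m w) (z *m w).
  by rewrite bform_mull trmxK bformE1.
have -> : bform (z^T *m B) w w = bform 1%:M (B *m w) (z *m w).
  by rewrite bform_mull trmxK bformE1 bform1C.
have -> : bform (z^T *m A *m z) w w = bform A (z *m w) (z *m w).
  by rewrite -[_ *m A *m _]mulmxA bform_mull trmxK bform_mulr.
have -> : bform B (z *m w) w = bform 1%:M (B *m w) (z *m w) by rewrite bformE1 bform1C.
have -> : bform B (invmx A *m B *m w) w = bform 1%:M (B *m w) (invmx A *m (B *m w)).
  by rewrite bformE1 bform1C mulmxA.
have -> : bform A (invmx A *m B *m w) (invmx A *m B *m w) =
    bform 1%:M (B *m w) (invmx A *m (B *m w)).
  by rewrite bformE1 !mulmxA mulmxV // mul1mx bform1C.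
have : \sum_i (bform (tau i *: (xdot i *m (xdot i)^T - delta%:M)) w w
   + 2 * bform (tau i *: - (l i *m (xdot i)^T)) (z *m w) w
   + bform (tau i *: (l i *m (l i)^T)) (z *m w) (z *m w)) <= 0.
  apply: sumr_le0 => i _; rewrite !bformZm mulrCA -!mulrDr mulr_ge0_le0 //.
  rewrite !(bformBm, bformNm) bform_scalar.
  have rank1 k k' (u : 'cV[R]_k) (v : 'cV[R]_k') a b :
      bform (u *m v^T) a b = bform 1%:M u a * bform 1%:M v b.
    rewrite bform_mull bformE1 /bform mulmx1 mulmxA.
    have -> : (u^T *m a)^T *m v^T *m b = (u^T *m a)^T *m (v^T *m b) by rewrite mulmxA.
    by rewrite !mulmx1 [LHS]mxE big_ord1 !mxE; congr (_ * _);
       apply: eq_bigr => j _; rewrite !mxE mulrC.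
  rewrite !rank1.
  have -> : bform 1%:M (l i) (z *m w) = bform 1%:M (xdot i) w - bform 1%:M (d i) w.
    by rewrite xdotE bformDl addrK [RHS]bform1C -[RHS]bformE1 [RHS]bformT trmxK [RHS]bformE1.
  have : bform 1%:M (d i) w ^+ 2 <= delta * bform 1%:M w w.
    apply: le_trans (cauchy_schwarz _ _) _; apply: ler_wpM2r; first exact: qform1_ge0.
    by rewrite -[bform _ _ _]/(qform _ _) -sqr_enorm.
  move=> dW; rewrite -subr_ge0 in dW.
  rewrite -oppr_ge0; apply: (le_trans dW); rewrite le_eqVlt; apply/orP; left.
  by apply/eqP; ring.
rewrite !big_split /= -mulr_sumr.
lra.
Qed.

End LinearAlgebra.

(** * Polynomial maps: evaluation, sums of squares, derivatives *)

Section PolynomialMaps.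
Context {R : realType}.

Lemma normr_coord m n (A : 'M[R]_(m, n)) i j : `|A i j| <= `|A|.
Proof.
rewrite [leRHS]/Num.Def.normr/= mx_normrE.
exact: (le_bigmax _ (fun ij : 'I_m * 'I_n => `|A ij.1 ij.2|) (i, j)).
Qed.

Lemma normr_mx_le m n (A : 'M[R]_(m, n)) e :
  0 <= e -> (forall i j, `|A i j| <= e) -> `|A| <= e.
Proof.
move=> e0 Ae; rewrite [leLHS]/Num.Def.normr/= mx_normrE.
by apply: bigmax_le => // -[i j] _; exact: Ae.
Qed.

(** Each monomial is unfolded into a product of variables, so that a property stable under sums and
    products is checked on generators only. *)
Lemma mpoly_alg_ind k (P : mpolynomial R k -> Prop) :
  (forall c, P (mpoly.mpolyC k c)) ->
  (forall i, P (mpoly.mpolyX R (mpoly.mnm1 i))) ->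
  (forall p q, P p -> P q -> P (p + q)) ->
  (forall p q, P p -> P q -> P (p * q)) ->
  forall p, P p.
Proof.
move=> PC PX PD PM; elim/mpoly.mpolyind => [|c a p _ _ Pp].
  by have := PC 0; rewrite mpoly.mpolyC0.
apply: (PD _ _) => //; rewrite -mpoly.mul_mpolyC; apply: (PM _ _) => //.
rewrite mpoly.mpolyXE_id; elim/big_ind: _ => [||i _].
- by have := PC 1; rewrite mpoly.mpolyC1.
- exact: PM.
- elim: (mpoly.fun_of_multinom a i) => [|l IH]; last by rewrite exprS; exact: (PM _ _).
  by rewrite expr0; have := PC 1; rewrite mpoly.mpolyC1.
Qed.

Lemma pevalM k (p q : mpolynomial R k) x : peval (p * q) x = peval p x * peval q x.
Proof. exact: mpoly.mevalM. Qed.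

Lemma pevalD k (p q : mpolynomial R k) x : peval (p + q) x = peval p x + peval q x.
Proof. exact: mpoly.mevalD. Qed.

Lemma peval_sum k I (r : seq I) (F : I -> mpolynomial R k) x :
  peval (\sum_(i <- r) F i) x = \sum_(i <- r) peval (F i) x.
Proof.
elim/big_ind2: _ => [|? ? ? ? <- <-|//]; first exact: mpoly.meval0.
exact: pevalD.
Qed.

Lemma pmevalM k p q r (A : 'M[mpolynomial R k]_(p, q)) (B : 'M[mpolynomial R k]_(q, r)) x :
  pmeval (A *m B) x = pmeval A x *m pmeval B x.
Proof.
apply/matrixP => i j; rewrite !mxE peval_sum; apply: eq_bigr => l _.
by rewrite pevalM !mxE.
Qed.

Lemma sos_mx_ge0 k p (S : 'M[mpolynomial R k]_p) x v :
  sos_mx S -> 0 <= qform (pmeval S x) v.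
Proof.
move=> [q [Q ->]]; rewrite pmevalM.
have -> : pmeval Q^T x = (pmeval Q x)^T by apply/matrixP => i j; rewrite !mxE.
by rewrite qformE bform_mull trmxK bformE1 qform1_ge0.
Qed.

Lemma sos_ge0 k (p : mpolynomial R k) x : sos p -> 0 <= peval p x.
Proof.
move=> [s ->]; rewrite peval_sum; apply: sumr_ge0 => q _.
by rewrite expr2 pevalM -expr2 sqr_ge0.
Qed.

(** The domain [V] of [phi] is arbitrary so that one chain rule serves twice: with [phi] the
    identity it identifies the Jacobian, with [phi] a curve it differentiates along trajectories. *)
Lemma is_derive_peval (V : normedModType R) k (phi : V -> 'cV[R]_k) a v
    (w : 'cV[R]_k) (p : mpolynomial R k) :
  (forall i, is_derive a v (fun t => phi t i ord0) (w i ord0)) ->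
  is_derive a v (fun t => peval p (phi t))
    (\sum_i peval (mpoly.mderiv i p) (phi a) * w i ord0).
Proof.
move=> dphi; elim/mpoly_alg_ind: p => [c|i|p q dp dq|p q dp dq].
- have -> : (fun t => peval (mpoly.mpolyC k c) (phi t)) = cst c.
    by apply/funext => t; rewrite /peval mpoly.mevalC.
  apply: is_derive_eq; rewrite big1 // => i _.
  by rewrite mpoly.mderivC /peval mpoly.meval0 mul0r.
- have -> : (fun t => peval (mpoly.mpolyX R (mpoly.mnm1 i)) (phi t)) =
      (fun t => phi t i ord0).
    by apply/funext => t; rewrite /peval mpoly.mevalXU.
  apply: is_derive_eq; rewrite (bigD1 i) //= big1 ?addr0 => [|j ji].
    rewrite mpoly.mderivX mpoly.mnm1E eqxx scale1r.
    have -> : mpoly.mnm_sub (mpoly.mnm1 i) (mpoly.mnm1 i) = mpoly.mnm0 :> mpoly.multinom k.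
      by apply/mpoly.mnmP => j; rewrite mpoly.mnmBE subnn mpoly.mnm0E.
    by rewrite mpoly.mpolyX0 /peval mpoly.meval1 mul1r.
  by rewrite mpoly.mderivX mpoly.mnm1E eq_sym (negbTE ji) scale0r /peval mpoly.meval0 mul0r.
- have -> : (fun t => peval (p + q) (phi t)) =
      (fun t => peval p (phi t)) + (fun t => peval q (phi t)).
    by apply/funext => t; rewrite pevalD.
  apply: is_derive_eq; rewrite -big_split /=; apply: eq_bigr => i _.
  by rewrite mpoly.mderivD pevalD mulrDl.
- have -> : (fun t => peval (p * q) (phi t)) =
      (fun t => peval p (phi t)) * (fun t => peval q (phi t)).
    by apply/funext => t; rewrite pevalM.
  apply: is_derive_eq; rewrite -[_ *: _]/(_ * _) -[X in _ + X]/(_ * _).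
  rewrite !mulr_sumr -big_split /=; apply: eq_bigr => i _.
  by rewrite mpoly.mderivM pevalD !pevalM; ring.
Qed.

Lemma jacobian_mx_pmeval k p (f : 'cV[mpolynomial R k]_p) x :
  jacobian_mx (pmeval f) x = \matrix_(i, j) peval (mpoly.mderiv j (f i ord0)) x.
Proof.
apply/matrixP => i j; rewrite !mxE.
have -> : (fun y => pmeval f y i ord0) = (fun y => peval (f i ord0) (id y)).
  by apply/funext => y; rewrite mxE.
have dco l : is_derive x (delta_mx j ord0 : 'cV[R]_k) (fun y : 'cV[R]_k => id y l ord0)
    ((delta_mx j ord0 : 'cV[R]_k) l ord0).
  split; first exact/diff_derivable/differentiable_coord.
  have did : derivable (@id 'cV[R]_k) x (delta_mx j ord0) by exact: derivable_id.
  have := derive_mx did; rewrite derive_id => /(congr1 (fun M : 'cV[R]_k => M l ord0)).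
  by rewrite [RHS]mxE => <-.
have [_ ->] := is_derive_peval (f i ord0) dco.
rewrite (bigD1 j) //= big1 ?addr0 => [|l lj]; rewrite !mxE ?eqxx ?mulr1 //.
by rewrite (negbTE lj) mulr0.
Qed.

Lemma is_derive_coord (V : normedModType R) k (phi : V -> 'cV[R]_k) a v w :
  is_derive a v phi w -> forall i, is_derive a v (fun t => phi t i ord0) (w i ord0).
Proof.
move=> [dphi <-] i; split; first by have /derivable_mxP := dphi; exact.
by rewrite derive_mx // mxE.
Qed.

Lemma is_derive_cV (V : normedModType R) k (phi : V -> 'cV[R]_k) a v (w : 'cV[R]_k) :
  (forall i, is_derive a v (fun t => phi t i ord0) (w i ord0)) -> is_derive a v phi w.
Proof.
move=> dphi; have dd : derivable phi a v.
  by apply/derivable_mxP => i j; rewrite ord1; case: (dphi i).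
split=> //; rewrite derive_mx //; apply/matrixP => i j; rewrite ord1 mxE.
by case: (dphi i).
Qed.

Lemma is_derive_pmeval (V : normedModType R) k p (f : 'cV[mpolynomial R k]_p)
    (phi : V -> 'cV[R]_k) a v w : is_derive a v phi w ->
  is_derive a v (fun t => pmeval f (phi t)) (jacobian_mx (pmeval f) (phi a) *m w).
Proof.
move=> dphi; apply: is_derive_cV => i.
have -> : (fun t => pmeval f (phi t) i ord0) = (fun t => peval (f i ord0) (phi t)).
  by apply/funext => y; rewrite mxE.
apply: is_derive_eq; first exact: (is_derive_peval (f i ord0) (is_derive_coord dphi)).
by rewrite jacobian_mx_pmeval mxE; apply: eq_bigr => j _; rewrite mxE.
Qed.

Lemma is_derive_qform (V : normedModType R) k (Q : 'M[R]_k) (phi : V -> 'cV[R]_k) a v w :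
  Q^T = Q -> is_derive a v phi w ->
  is_derive a v (fun t => qform Q (phi t)) (2 * bform Q (phi a) w).
Proof.
move=> sQ dphi.
have bE u z : bform Q u z = \sum_i \sum_j Q i j * (u i ord0 * z j ord0).
  rewrite /bform mxE exchange_big; apply: eq_bigr => j _.
  rewrite mxE mulr_suml; apply: eq_bigr => i _; rewrite mxE; ring.
have dco := is_derive_coord dphi.
pose h i j : V -> R := cst (Q i j) * ((fun t => phi t i ord0) * (fun t => phi t j ord0)).
have dh i j : is_derive a v (h i j)
    (Q i j * (phi a i ord0 * w j ord0 + phi a j ord0 * w i ord0)).
  apply: is_derive_eq; rewrite scaler0 addr0.
  by rewrite -![_ *: _]/(_ * _).
have dsum := is_derive_sum (fun i => is_derive_sum (dh i)).
rewrite (_ : (fun t => qform Q (phi t)) = \sum_(i < k) \sum_(j < k) h i j); last first.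
  apply/funext => t; rewrite qformE bE fct_sumE; apply: eq_bigr => i _.
  by rewrite fct_sumE.
apply: (is_derive_eq dsum).
have -> : 2 * bform Q (phi a) w = bform Q (phi a) w + bform Q w (phi a).
  by rewrite (bformT Q w) sQ; ring.
rewrite !bE -big_split; apply: eq_bigr => i _ /=; rewrite -big_split.
apply: eq_bigr => j _ /=; ring.
Qed.

End PolynomialMaps.

(** * Maps that are Lipschitz on every ball *)

Section LipschitzOnBoundedSets.
Context {R : realType} {k : nat}.
Implicit Types (g h : 'cV[R]_k -> R).

(** Unlike a global Lipschitz condition this is stable under products, so it holds for all
    polynomials. It yields continuity, the local Lipschitz clause of [ISS], and the constant used
    for the saturated field. *)
Definition lipschitz_on_balls g := forall r : R, exists2 L : R, 0 <= L &
  forall x y, `|x| <= r -> `|y| <= r -> `|g x - g y| <= L * `|x - y|.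

Definition lipschitz_on_balls_mx p q (F : 'cV[R]_k -> 'M[R]_(p, q)) :=
  forall i j, lipschitz_on_balls (fun x => F x i j).

Lemma lipschitz_on_balls_cst c : lipschitz_on_balls (fun=> c).
Proof. by move=> r; exists 0 => // x y _ _; rewrite subrr normr0 mul0r. Qed.

Lemma lipschitz_on_balls_coord i j : lipschitz_on_balls (fun x => x i j).
Proof.
move=> r; exists 1 => // x y _ _; rewrite mul1r.
by have := normr_coord (x - y) i j; rewrite !mxE.
Qed.

Lemma lipschitz_on_ballsD g h : lipschitz_on_balls g -> lipschitz_on_balls h ->
  lipschitz_on_balls (fun x => g x + h x).
Proof.
move=> gL hL r; have [L L0 gxy] := gL r; have [K K0 hxy] := hL r.
exists (L + K) => [|x y xr yr]; first exact: addr_ge0.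
rewrite opprD addrACA mulrDl; apply: le_trans (ler_normD _ _) _.
by apply: lerD; [exact: gxy|exact: hxy].
Qed.

Lemma lipschitz_on_ballsM g h : lipschitz_on_balls g -> lipschitz_on_balls h ->
  lipschitz_on_balls (fun x => g x * h x).
Proof.
move=> gL hL r; have [L L0 gxy] := gL r; have [K K0 hxy] := hL r.
have [r0|r0] := ltP r 0.
  by exists 0 => // x y xr; have := le_lt_trans xr r0; rewrite ltNge normr_ge0.
(* A Lipschitz function is bounded on the ball by comparison with its value at 0, which lies in the
   ball as [r] is now nonnegative. *)
have bnd (f : 'cV[R]_k -> R) (C : R) : 0 <= C -> (forall x y : 'cV[R]_k, `|x| <= r -> `|y| <= r ->
    `|f x - f y| <= C * `|x - y|) -> forall x, `|x| <= r -> `|f x| <= C * r + `|f 0|.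
  move=> C0 fxy x xr; rewrite -[f x](subrK (f 0)); apply: le_trans (ler_normD _ _) _.
  rewrite lerD2r; apply: le_trans (fxy _ _ xr _) _; first by rewrite normr0.
  by rewrite subr0; exact: ler_wpM2l.
have gB := bnd g L L0 gxy; have hB := bnd h K K0 hxy.
exists (L * (K * r + `|h 0|) + (L * r + `|g 0|) * K) => [|x y xr yr].
  by rewrite !(addr_ge0, mulr_ge0).
have -> : g x * h x - g y * h y = (g x - g y) * h x + g y * (h x - h y) by ring.
rewrite [leRHS]mulrDl; apply: le_trans (ler_normD _ _) _; rewrite !normrM; apply: lerD.
  rewrite mulrAC; apply: ler_pM => //; [exact: gxy|exact: hB].
by rewrite -mulrA; apply: ler_pM => //; [exact: gB|exact: hxy].
Qed.

Lemma lipschitz_on_balls_sum I (r : seq I) (F : I -> 'cV[R]_k -> R) :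
  (forall i, lipschitz_on_balls (F i)) ->
  lipschitz_on_balls (fun x => \sum_(i <- r) F i x).
Proof.
move=> FL; elim: r => [|i r IH].
  under eq_fun do rewrite big_nil.
  exact: lipschitz_on_balls_cst.
under eq_fun do rewrite big_cons.
exact: lipschitz_on_ballsD.
Qed.

Lemma lipschitz_on_balls_peval (p : mpolynomial R k) : lipschitz_on_balls (peval p).
Proof.
elim/(@mpoly_alg_ind R): p => [c|i|p q pL qL|p q pL qL].
- have -> : peval (mpoly.mpolyC k c) = fun=> c.
    by apply/funext => x; rewrite /peval mpoly.mevalC.
  exact: lipschitz_on_balls_cst.
- have -> : peval (mpoly.mpolyX R (mpoly.mnm1 i)) = fun x => x i ord0.
    by apply/funext => x; rewrite /peval mpoly.mevalXU.
  exact: lipschitz_on_balls_coord.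
- by under [X in lipschitz_on_balls X]funext do rewrite pevalD; exact: lipschitz_on_ballsD.
- by under [X in lipschitz_on_balls X]funext do rewrite pevalM; exact: lipschitz_on_ballsM.
Qed.

Lemma lipschitz_on_balls_continuous g : lipschitz_on_balls g -> continuous g.
Proof.
move=> gL x; have [L L0 gxy] := gL (`|x| + 1).
have LV1 : 0 < L + 1 by rewrite ltr_wpDl.
have Fx : Filter (nbhs x) by exact: nbhs_filter.
apply/cvgrPdist_lt => e e0.
have d0 : 0 < Num.min 1 (e / (L + 1)) by rewrite lt_min ltr01 divr_gt0.
apply: (filterS _ (nbhsx_ballx x _ d0)).
move=> y; rewrite -ball_normE /= lt_min => /andP[xy1 xye].
apply: le_lt_trans (gxy _ _ _ _) _.
- by rewrite lerDl.
- rewrite -[y](subKr x); apply: le_trans (ler_normB _ _) _.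
  by rewrite lerD2l ltW.
- move: xye; rewrite ltr_pdivlMr ?ltr_wpDl // mulrC; apply: le_lt_trans.
  by apply: ler_wpM2r => //; rewrite lerDl.
Qed.

Lemma lipschitz_on_balls_mx_cst p q (A : 'M[R]_(p, q)) : lipschitz_on_balls_mx (fun=> A).
Proof. move=> i j; exact: lipschitz_on_balls_cst. Qed.

Lemma lipschitz_on_balls_mx_id : lipschitz_on_balls_mx id.
Proof. move=> i j; exact: lipschitz_on_balls_coord. Qed.

Lemma lipschitz_on_balls_mx_pmeval p q (A : 'M[mpolynomial R k]_(p, q)) :
  lipschitz_on_balls_mx (pmeval A).
Proof.
move=> i j; have -> : (fun x => pmeval A x i j) = peval (A i j).
  by apply/funext => x; rewrite mxE.
exact: lipschitz_on_balls_peval.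
Qed.

Lemma lipschitz_on_balls_mxM p q s (A : 'cV[R]_k -> 'M[R]_(p, q))
    (B : 'cV[R]_k -> 'M[R]_(q, s)) :
  lipschitz_on_balls_mx A -> lipschitz_on_balls_mx B ->
  lipschitz_on_balls_mx (fun x => A x *m B x).
Proof.
move=> AL BL i j; under eq_fun do rewrite mxE.
by apply: lipschitz_on_balls_sum => l; apply: lipschitz_on_ballsM.
Qed.

Lemma lipschitz_on_balls_mx_tr p q (A : 'cV[R]_k -> 'M[R]_(p, q)) :
  lipschitz_on_balls_mx A -> lipschitz_on_balls_mx (fun x => (A x)^T).
Proof. by move=> AL i j; under eq_fun do rewrite mxE; exact: AL. Qed.

Lemma lipschitz_on_balls_mx_col p q s (A : 'cV[R]_k -> 'M[R]_(p, s))
    (B : 'cV[R]_k -> 'M[R]_(q, s)) :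
  lipschitz_on_balls_mx A -> lipschitz_on_balls_mx B ->
  lipschitz_on_balls_mx (fun x => col_mx (A x) (B x)).
Proof.
move=> AL BL i j; case: (split_ordP i) => l ->.
  by under eq_fun do rewrite col_mxEu; exact: AL.
by under eq_fun do rewrite col_mxEd; exact: BL.
Qed.

Lemma lipschitz_on_balls_qform p (A : 'cV[R]_k -> 'M[R]_p) (z : 'cV[R]_k -> 'cV[R]_p) :
  lipschitz_on_balls_mx A -> lipschitz_on_balls_mx z ->
  lipschitz_on_balls (fun x => qform (A x) (z x)).
Proof.
move=> AL zL; apply: lipschitz_on_balls_mxM => //.
by apply: lipschitz_on_balls_mxM => //; exact: lipschitz_on_balls_mx_tr.
Qed.

Lemma lipschitz_on_balls_norm p (F : 'cV[R]_k -> 'cV[R]_p) (r : R) :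
  lipschitz_on_balls_mx F -> exists2 L : R, 0 <= L &
    forall x y, `|x| <= r -> `|y| <= r -> `|F x - F y| <= L * `|x - y|.
Proof.
move=> FL; pose Q i L := 0 <= L /\ forall x y, `|x| <= r -> `|y| <= r ->
  `|F x i ord0 - F y i ord0| <= L * `|x - y|.
have /choice[L QL] : forall i, exists L, Q i L.
  by move=> i; have [L L0 FL'] := FL i ord0 r; exists L.
exists (\sum_i L i) => [|x y xr yr]; first by apply: sumr_ge0 => i _; case: (QL i).
apply: normr_mx_le => [|i j].
  by rewrite mulr_ge0 // sumr_ge0 // => i _; case: (QL i).
rewrite ord1 !mxE; apply: le_trans ((QL i).2 _ _ xr yr) _.
apply: ler_wpM2r => //; rewrite (bigD1 i) //= lerDl sumr_ge0 // => l _.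
by case: (QL l).
Qed.

Lemma locally_lipschitzD (F : 'cV[R]_k -> 'cV[R]_k) :
  lipschitz_on_balls_mx F -> locally_lipschitz (fun x d => F x + d).
Proof.
move=> FL z; have [L L0 FB] := lipschitz_on_balls_norm (`|z.1| + 1) FL.
exists (ball z 1); first exact: nbhsx_ballx.
have PF : ProperFilter (globally (ball z (1 : R) `*` ball z (1 : R))).
  by apply: (@globally_properfilter _ _ (z, z)); split; exact: ballxx.
apply: (@klipschitzW _ _ _ (L + 1)) => -[y y'] /= [zy zy'].
have bnd (w : 'cV[R]_k * 'cV[R]_k) : ball z 1 w -> `|w.1| <= `|z.1| + 1.
  case=> /= + _; rewrite -ball_normE /= => zw.
  by rewrite -[w.1](subKr z.1); apply: le_trans (ler_normB _ _) _; rewrite lerD2l ltW.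
rewrite opprD addrACA mulrDl mul1r; apply: le_trans (ler_normD _ _) _; apply: lerD.
  apply: le_trans (FB _ _ (bnd _ zy) (bnd _ zy')) _; apply: ler_wpM2l => //.
  by rewrite prod_normE /= le_max lexx.
by rewrite prod_normE /= le_max lexx orbT.
Qed.

End LipschitzOnBoundedSets.

(** * The Euclidean norm, and coercivity of the inverse of a positive definite matrix *)

Section EuclideanNorm.
Context {R : realType} {k : nat}.
Implicit Types x : 'cV[R]_k.

Lemma enorm_ge0 x : 0 <= enorm x.
Proof. exact: sqrtr_ge0. Qed.

Lemma enorm0 : enorm (0 : 'cV[R]_k) = 0.
Proof. by rewrite /enorm big1 ?sqrtr0 // => i _; rewrite mxE expr0n. Qed.

Lemma enorm_gt0 x : x != 0 -> 0 < enorm x.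
Proof.
move=> x0; rewrite lt0r enorm_ge0 andbT; apply: contra x0 => /eqP e0.
by apply/eqP/qform1_eq0; rewrite -sqr_enorm e0 expr0n.
Qed.

Lemma normr_le_enorm x : `|x| <= enorm x.
Proof.
apply: normr_mx_le => [|i j]; first exact: enorm_ge0.
rewrite ord1 -sqrtr_sqr ler_sqrt; last by apply: sumr_ge0 => l _; exact: sqr_ge0.
by rewrite (bigD1 i) //= lerDl sumr_ge0 // => l _; exact: sqr_ge0.
Qed.

Lemma lipschitz_on_balls_sqr_enorm : lipschitz_on_balls (fun x => enorm x ^+ 2).
Proof.
under eq_fun do rewrite sqr_enorm.
apply: lipschitz_on_balls_qform; last exact: lipschitz_on_balls_mx_id.
exact: lipschitz_on_balls_mx_cst.
Qed.

Lemma enorm_continuous : continuous (@enorm R k).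
Proof.
move=> x; rewrite (_ : @enorm R k = fun y => Num.sqrt (enorm y ^+ 2)); last first.
  by apply/funext => y; rewrite sqrtr_sqr ger0_norm // enorm_ge0.
apply: (continuous_comp (f := fun y => enorm y ^+ 2)); last exact: sqrt_continuous.
exact: lipschitz_on_balls_continuous lipschitz_on_balls_sqr_enorm _.
Qed.

Lemma enorm_posdef : positive_definite (@enorm R k).
Proof. by split; [exact: enorm0|exact: enorm_gt0]. Qed.

Lemma enorm_unbounded : radially_unbounded (@enorm R k).
Proof. by move=> K; exists K. Qed.

(* [|P y|^2 <= C y^T P y], obtained by testing [P] at [y - C^-1 P y]. *)
Lemma sqr_enorm_le_qform_inv (P : 'M[R]_k) : posdef P ->
  exists2 C, 0 < C & forall z, enorm z ^+ 2 <= C * qform (invmx P) z.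
Proof.
move=> pP; have uP := posdef_unitmx pP; have [sP Pge0] := posdef_semi pP.
(* The Lipschitz constant on the unit ball, compared with the value at 0, bounds the form there;
   homogeneity extends this to [qform P v <= L |v|^2]. The constant [C] is [L + 1] to be
   positive. *)
have [L L0 PL] := lipschitz_on_balls_qform (lipschitz_on_balls_mx_cst P)
  lipschitz_on_balls_mx_id 1.
have qZ (c : R) (v : 'cV[R]_k) : qform P (c *: v) = c ^+ 2 * qform P v.
  by rewrite !qformE bformZl bformZr; ring.
have PB (v : 'cV[R]_k) : qform P v <= L * enorm v ^+ 2.
  have [->|v0] := eqVneq v 0.
    by rewrite /qform mulmx0 mxE mulr_ge0 // sqr_ge0.
  have nv0 : 0 < `|v| by rewrite normr_gt0.
  have := PL (`|v|^-1 *: v) 0.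
  rewrite normr0 normrZ normfV normr_id mulVf ?gt_eqF // => /(_ (lexx _) ler01).
  have -> : qform P 0 = 0 by rewrite /qform mulmx0 mxE.
  rewrite !subr0 normrZ normfV normr_id mulVf ?gt_eqF // mulr1 qZ.
  rewrite ger0_norm ?mulr_ge0 ?sqr_ge0 // exprVn mulrC ler_pdivrMr ?exprn_gt0 //.
  move=> /le_trans; apply; apply: ler_wpM2l => //.
  by rewrite ler_pXn2r // ?nnegrE ?enorm_ge0 // normr_le_enorm.
exists (L + 1) => [|z]; first by rewrite ltr_wpDl.
have C0 : 0 < L + 1 by rewrite ltr_wpDl.
set y := invmx P *m z.
have zE : z = P *m y by rewrite mulmxA mulmxV // mul1mx.
have yz : qform (invmx P) z = bform 1%:M z y by rewrite qformE bformE1.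
have := Pge0 (y + (- (L + 1)^-1) *: z).
rewrite qformE !(bformDl, bformDr, bformZl, bformZr).
have -> : bform P z y = enorm z ^+ 2 by rewrite bformE1 -zE sqr_enorm.
have -> : bform P y z = enorm z ^+ 2 by rewrite bformT sP bformE1 -zE sqr_enorm.
have -> : bform P y y = bform 1%:M z y by rewrite bformE1 -zE bform1C.
have := PB z; rewrite yz qformE; set e := enorm z ^+ 2.
have e0 : 0 <= e by exact: sqr_ge0.
set a := bform P z z; set b := bform 1%:M z y => aLe H.
have {}aLe : a <= (L + 1) * e by apply: le_trans aLe _; rewrite ler_wpM2r // lerDl.
rewrite mulrC -ler_pdivrMr // mulrC.
set c := (L + 1)^-1 in H *.
have c0 : 0 < c by rewrite invr_gt0.
have cC : c * (L + 1) = 1 by rewrite mulVf // gt_eqF.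
(* With [c = 1 / C] the test reads [0 <= b - 2 c e + c^2 a], so [c a <= e] gives [c e <= b]. *)
have : c * a <= e.
  by have := ler_wpM2l (ltW c0) aLe; rewrite mulrA cC mul1r.
move=> /(ler_wpM2l (ltW c0)) cae; move: H cae.
have -> : - c * (- c * a) = c * (c * a) by ring.
by set x := c * (c * a); lra.
Qed.

End EuclideanNorm.

(** * Gains, and domination of one function by a gain of another *)

Section ComparisonFunctions.
Context {R : realType}.

(* A class K function extended increasingly to the whole line, so that composites are
   continuous without domain conditions. *)
Definition strict_gain (kappa : R -> R) : Prop :=
  [/\ continuous kappa, {homo kappa : r s / r < s} & kappa 0 = 0].

Lemma strict_gain_le kappa : strict_gain kappa -> {homo kappa : r s / r <= s}.
Proof. by case=> _ /ltW_homo. Qed.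

Lemma strict_gain_ge0 kappa s : strict_gain kappa -> 0 <= s -> 0 <= kappa s.
Proof. by move=> kK s0; have [_ _ <-] := kK; exact: strict_gain_le kK _ _ s0. Qed.

Lemma strict_gain_class_K kappa : strict_gain kappa -> class_K kappa.
Proof.
case=> kc ki k0; split=> //; last by move=> r s _ _; exact: ki.
exact: continuous_subspaceT.
Qed.

Lemma strict_gain_id : strict_gain id.
Proof. by split=> // x; exact: cvg_id. Qed.

Lemma strict_gainZ c : 0 < c -> strict_gain ( *%R c).
Proof.
move=> c0; split=> [x|r s rs|]; last exact: mulr0.
  exact: mulrl_continuous.
by rewrite ltr_pM2l.
Qed.

Lemma strict_gain_comp kappa mu : strict_gain kappa -> strict_gain mu ->
  strict_gain (kappa \o mu).
Proof.
move=> [kc ki k0] [mc mi m0]; split=> [x|r s rs|]; last by rewrite /= m0.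
  by apply: continuous_comp; [exact: mc|exact: kc].
by apply: ki; exact: mi.
Qed.

Lemma strict_gainD kappa mu : strict_gain kappa -> strict_gain mu ->
  strict_gain (fun s => kappa s + mu s).
Proof.
move=> [kc ki k0] [mc mi m0]; split=> [x|r s rs|]; last by rewrite k0 m0 addr0.
  by apply: cvgD; [exact: kc|exact: mc].
by apply: ltrD; [exact: ki|exact: mi].
Qed.

(** The weak triangle inequality: twice the larger of [r] and [s] already dominates their sum. It
    separates the initial state from the input in the final estimate. *)
Lemma strict_gain_add_le kappa r s : strict_gain kappa -> 0 <= r -> 0 <= s ->
  kappa (r + s) <= kappa (2 * r) + kappa (2 * s).
Proof.
move=> kK r0 s0; have [rs|/ltW rs] := leP r s.
  apply: (@le_trans _ _ (kappa (2 * s))); first by apply: (strict_gain_le kK); lra.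
  by rewrite lerDr (strict_gain_ge0 kK) // mulr_ge0.
apply: (@le_trans _ _ (kappa (2 * r))); first by apply: (strict_gain_le kK); lra.
by rewrite lerDl (strict_gain_ge0 kK) // mulr_ge0.
Qed.

Section Domination.
Context {T : Type}.
Variables (f g : T -> R).
Hypothesis g_ge0 : forall x, 0 <= g x.
Hypothesis f_bounded : forall M : R, exists B : R, forall x, g x <= M -> f x <= B.
Hypothesis f_small : forall e : R, 0 < e ->
  exists2 d : R, 0 < d & forall x, g x <= d -> f x <= e.

Let clip (u : R) : R := Num.max 0 (Num.min 1 u).
Let pos x : R := Num.max 0 (f x).
(** The element 0 keeps the set nonempty even when [T] is empty. *)
Let values (s : R) : set R :=
  [set y | y = 0 \/ exists x, y = pos x * clip (2 - g x / s)].

(* The supremum of [f] over [g <= 2 s], weighted by a cutoff that is 1 on [g <= s];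
   the cutoff makes it continuous in [s]. *)
Let envelope (s : R) : R := sup (values s).

Let clip01 u : 0 <= clip u <= 1.
Proof. by rewrite /clip le_max lexx ge_max ler01 ge_min lexx. Qed.

Let pos_ge0 x : 0 <= pos x.
Proof. by rewrite /pos le_max lexx. Qed.

Let values_le s B : 0 < s -> 0 <= B -> (forall x, g x <= 2 * s -> f x <= B) ->
  ubound (values s) B.
Proof.
move=> s0 B0 fB y [->//|[x ->]]; have [gx|gx] := leP (g x) (2 * s).
  have /andP[c0 c1] := clip01 (2 - g x / s).
  apply: (@le_trans _ _ (pos x)); first by rewrite -[leRHS]mulr1 ler_wpM2l.
  by rewrite /pos ge_max B0 fB.
suff -> : clip (2 - g x / s) = 0 by rewrite mulr0.
apply/max_idPl; rewrite ge_min; apply/orP; right.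
by rewrite subr_le0 ler_pdivlMr // ltW.
Qed.

Let values_sup s : 0 < s -> has_sup (values s).
Proof.
move=> s0; split; first by exists 0; left.
have [B fB] := f_bounded (2 * s); exists (Num.max 0 B); apply: values_le => //.
  by rewrite le_max lexx.
by move=> x /fB fx; rewrite le_max fx orbT.
Qed.

Let envelope_ge0 s : 0 < s -> 0 <= envelope s.
Proof. by move=> /values_sup vs; apply: sup_upper_bound => //; left. Qed.

Let envelope_le s B : 0 < s -> 0 <= B -> (forall x, g x <= 2 * s -> f x <= B) ->
  envelope s <= B.
Proof.
move=> s0 B0 fB; apply: ge_sup; first by exists 0; left.
exact: values_le.
Qed.

Let envelope_dom x : 0 < g x -> f x <= envelope (g x).
Proof.
move=> gx0; apply: (@le_trans _ _ (pos x)); first by rewrite /pos le_max lexx orbT.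
apply: sup_upper_bound; first exact: values_sup.
right; exists x; rewrite divff ?gt_eqF //.
have -> : 2 - 1 = 1 :> R by ring.
by rewrite /clip minxx (max_idPr ler01) mulr1.
Qed.

Let envelope_mono s s' : 0 < s -> s <= s' -> envelope s <= envelope s'.
Proof.
move=> s0 ss'; have s'0 := lt_le_trans s0 ss'.
apply: ge_sup => [|_ [->|[x ->]]]; first by exists 0; left.
  exact: envelope_ge0.
apply: (@le_trans _ _ (pos x * clip (2 - g x / s'))); last first.
  by apply: sup_upper_bound; [exact: values_sup|right; exists x].
apply: ler_wpM2l => //; rewrite /clip; apply: le_max2 => //; apply: le_min2 => //.
by rewrite lerD2l lerN2 ler_wpM2l // lef_pV2.
Qed.

(** On [g <= 2 s'] the argument of the cutoff moves by [g (1/s - 1/s') <= 2 (s' - s) / s], and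
    [clip] is nonexpansive; beyond [2 s'] both cutoffs vanish. *)
Let envelope_lip s s' B : 0 < s -> s <= s' -> 0 <= B ->
  (forall x, g x <= 2 * s' -> f x <= B) ->
  envelope s' <= envelope s + B * (2 * (s' - s) / s).
Proof.
move=> s0 ss' B0 fB; have s'0 := lt_le_trans s0 ss'.
have d0 : 0 <= 2 * (s' - s) / s.
  by rewrite divr_ge0 ?mulr_ge0 ?subr_ge0 // ltW.
apply: ge_sup => [|_ [->|[x ->]]]; first by exists 0; left.
  by rewrite addr_ge0 ?envelope_ge0 // mulr_ge0.
have [gx|gx] := leP (g x) (2 * s'); last first.
  suff -> : clip (2 - g x / s') = 0.
    by rewrite mulr0 addr_ge0 ?envelope_ge0 // mulr_ge0.
  apply/max_idPl; rewrite ge_min; apply/orP; right.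
  by rewrite subr_le0 ler_pdivlMr // ltW.
have posB : pos x <= B by rewrite /pos ge_max B0 fB.
apply: (@le_trans _ _ (pos x * (clip (2 - g x / s) + 2 * (s' - s) / s))); last first.
  rewrite mulrDr lerD ?ler_wpM2r //.
  by apply: sup_upper_bound; [exact: values_sup|right; exists x].
apply: ler_wpM2l => //.
have clipD u v : 0 <= v -> clip (u + v) <= clip u + v.
  move=> v0; rewrite /clip ge_max; apply/andP; split.
    by rewrite addr_ge0 // le_max lexx.
  rewrite ge_min; apply/orP; have [u1|u1] := leP u 1.
    by right; rewrite lerD2r le_max lexx orbT.
  by left; rewrite (max_idPr ler01) lerDl.
have -> : 2 - g x / s' = 2 - g x / s + (g x / s - g x / s') by ring.
have gle : g x / s - g x / s' <= 2 * (s' - s) / s.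
  have -> : g x / s - g x / s' = g x * ((s' - s) / (s * s')).
    by field; rewrite !gt_eqF.
  have -> : 2 * (s' - s) / s = 2 * s' * ((s' - s) / (s * s')).
    by field; rewrite !gt_eqF.
  by rewrite ler_wpM2r // divr_ge0 ?subr_ge0 // mulr_ge0 // ltW.
apply: le_trans (clipD _ _ _) _; last by rewrite lerD2l.
by rewrite subr_ge0 ler_wpM2l // lef_pV2.
Qed.

Lemma strict_gain_dominates :
  exists2 kappa, strict_gain kappa & forall x, f x <= kappa (g x).
Proof.
(* The envelope is only nondecreasing; the summand [s] makes [kappa] strictly increasing, also on
   the negative half-line. *)
pose kappa s := s + (if 0 < s then envelope s else 0).
exists kappa => [|x]; last first.
  rewrite /kappa; case: ltP => [gx0|gx0].
    by rewrite -[f x]add0r lerD // envelope_dom.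
  have -> : g x = 0 by apply/le_anti; rewrite gx0 g_ge0.
  (* Where [g] vanishes, [f_small] bounds [f] by every [e > 0]. *)
  rewrite addr0; apply/ler_addgt0Pr => e e0; rewrite add0r.
  have [d d0 fd] := f_small e0; apply: fd.
  by apply: le_trans gx0 _; exact: ltW.
split=> [a|r s rs|]; last by rewrite /kappa ltxx addr0.
  apply: cvgD; first exact: cvg_id.
  have [a0|a0|a0] := ltgtP a 0.
  - apply: cvg_near_cst; near=> s; rewrite ltNge.
    suff -> : s <= 0 by [].
    by apply: ltW; near: s; exact: lt_nbhsl.
  (* For [s] in [[a/2, 2 a]] the cutoff only sees [g <= 2 s <= 4 a]; with [1/s <= 2/a] this makes
     the envelope Lipschitz there with constant [C (4/a)]. *)
  - have [B fB] := f_bounded (4 * a); pose C := Num.max 0 B.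
    have C0 : 0 <= C by rewrite le_max lexx.
    have fC s x : s <= 2 * a -> g x <= 2 * s -> f x <= C.
      by move=> sa gx; rewrite /C le_max fB ?orbT //; lra.
    have lip s s' : a / 2 <= s -> s <= s' -> s' <= 2 * a ->
        `|envelope s - envelope s'| <= C * (4 / a) * (s' - s).
      move=> as_ ss' s'a.
      have s0 : 0 < s by lra.
      rewrite distrC ger0_norm ?subr_ge0; last exact: envelope_mono.
      rewrite lerBlDl; apply: le_trans (envelope_lip s0 ss' C0 _) _.
        by move=> x; exact: fC.
      rewrite lerD2l -!mulrA ler_wpM2l //.
      have -> : 2 * ((s' - s) / s) = 2 / s * (s' - s) by ring.
      rewrite mulrA ler_wpM2r ?subr_ge0 // ler_pdivrMr // mulrAC ler_pdivlMr //; lra.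
    apply/cvgrPdist_le => e e0.
    have CC : 0 < C * (4 / a) + 1 by rewrite ltr_wpDl // mulr_ge0 // divr_ge0 // ltW.
    near=> s.
    have sl : a / 2 < s by near: s; apply: lt_nbhsr; lra.
    have su : s < 2 * a by near: s; apply: lt_nbhsl; lra.
    have se : `|a - s| < e / (C * (4 / a) + 1).
      by near: s; apply: cvgr_dist_lt; [exact: cvg_id|exact: divr_gt0].
    have -> : 0 < s by lra.
    apply: (@le_trans _ _ (C * (4 / a) * `|a - s|)).
      have [as_|sa] := leP a s.
        by rewrite [`|a - s|]distrC [`|s - a|]ger0_norm ?subr_ge0 //; apply: lip => //; lra.
      rewrite distrC [`|a - s|]ger0_norm ?subr_ge0 ?(ltW sa) //; apply: lip => //; lra.
    move: se; rewrite ltr_pdivlMr // => /ltW; apply: le_trans.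
    by rewrite mulrC ler_wpM2l // lerDl.
  - rewrite a0; apply/cvgrPdist_le => e e0; have [d d0 fd] := f_small e0.
    near=> s; have sd : s < d / 2 by near: s; apply: lt_nbhsl; lra.
    case: ltP => [s0|_]; last by rewrite subrr normr0 ltW.
    rewrite sub0r normrN ger0_norm ?envelope_ge0 //; apply: envelope_le => //.
      exact: ltW.
    by move=> x gx; apply: fd; lra.
rewrite /kappa; apply: ltr_leD => //.
case: (ltP 0 r) => r0; first by rewrite (lt_trans r0 rs); apply: envelope_mono => //; exact: ltW.
by case: ifP => // s0; exact: envelope_ge0.
Unshelve. all: by end_near. Qed.

End Domination.

Lemma compact_sublevel k (g : 'cV[R]_k -> R) M : continuous g -> radially_unbounded g ->
  compact [set x | g x <= M].
Proof.
move=> gc gu; have [r gr] := gu M.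
(* Closed bounded sets are known to be compact for row vectors; transposition carries this over to
   columns. *)
have -> : [set x | g x <= M] =
    (fun v : 'rV[R]_k => v^T) @` [set v : 'rV[R]_k | g v^T <= M].
  apply/seteqP; split=> [x gx|_ [v gv <-]//].
  by exists x^T; rewrite /= trmxK.
have trc : continuous (fun v : 'rV[R]_k => v^T).
  move=> v; have Fv : Filter (nbhs v) by exact: nbhs_filter.
  apply/cvgrPdist_lt => e e0; apply: (filterS _ (nbhsx_ballx v _ e0)) => w.
  rewrite -ball_normE /= => vw; apply: le_lt_trans vw.
  by apply: normr_mx_le => // i j; have := normr_coord (v - w) j i; rewrite !mxE.
apply: continuous_compact; first exact: continuous_subspaceT.
apply: bounded_closed_compact.
  exists r; split; first exact: num_real.
  move=> s rs v /= gv; apply: le_trans (ltW rs).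
  have : `|v^T| <= r.
    apply: le_trans (normr_le_enorm _) _; rewrite leNgt.
    by apply/negP => /gr; rewrite ltNge gv.
  apply: le_trans; apply: normr_mx_le => // i j.
  by have := normr_coord v^T j i; rewrite mxE.
apply: (@closed_comp _ _ (g \o (fun v : 'rV[R]_k => v^T)) [set x | x <= M]); last exact: closed_le.
by move=> v _; apply: continuous_comp; [exact: trc|exact: gc].
Qed.

(** Radial unboundedness makes the sublevel sets of [g] compact, which bounds [f] on each of them
    and turns positivity of [g] away from 0 into a uniform lower bound. *)
Lemma strict_gain_dominates_cV k (f g : 'cV[R]_k -> R) :
  continuous f -> f 0 = 0 -> continuous g -> positive_definite g -> radially_unbounded g ->
  exists2 kappa, strict_gain kappa & forall x, f x <= kappa (g x).
Proof.
move=> fc f0 gc [g0 gpos] gu.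
have g_ge0 x : 0 <= g x by have [->|/gpos/ltW//] := eqVneq x 0; rewrite g0.
apply: strict_gain_dominates => // [M|e e0].
  have [M0|M0] := ltP M 0.
    by exists 0 => x gx; have := le_lt_trans gx M0; rewrite ltNge g_ge0.
  have ne : [set x | g x <= M] !=set0 by exists 0; rewrite /= g0.
  have [c _ fmax] := compact_EVT_max ne (compact_sublevel (M := M) gc gu)
    (continuous_subspaceT fc).
  by exists (f c) => x gx; apply: fmax; rewrite inE.
(* This compact set misses 0 because [f 0 = 0 < e], so the minimum of [g] on it is positive; any [d]
   below that minimum and at most 1 forces [f < e]. *)
pose K := [set x | g x <= 1] `&` [set x | e <= f x].
have Kc : compact K.
  apply: (@subclosed_compact _ _ [set x | g x <= 1]); last by move=> x [].
    apply: closedI; first exact: (closed_comp (fun x _ => gc x) (@closed_le _ _)).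
    exact: (closed_comp (fun x _ => fc x) (@closed_ge _ _)).
  exact: compact_sublevel.
have [[y Ky]|Kn] := pselect (K !=set0); last first.
  exists 1 => // x gx; rewrite leNgt; apply/negP => fx; apply: Kn; exists x.
  by split=> //=; exact: ltW.
have [c cK gmin] := compact_EVT_min (ex_intro _ y Ky) Kc (continuous_subspaceT gc).
have gc0 : 0 < g c.
  apply: gpos; apply/eqP => c0; move: cK; rewrite inE c0 => -[_ /=].
  by rewrite f0 leNgt e0.
exists (Num.min 1 (g c / 2)) => [|x]; first by rewrite lt_min ltr01 divr_gt0.
rewrite le_min => /andP[gx1 gxc]; rewrite leNgt; apply/negP => fx.
suff : g c <= g x by lra.
by apply: gmin; rewrite inE; split=> //=; exact: ltW.
Qed.

End ComparisonFunctions.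

(** * Differential inequalities off finite sets of times *)

Section DifferentialInequalities.
Context {R : realType}.
Implicit Types (h : R -> R) (a b c m t : R).

(** A function given on nonnegative times is frozen at its initial value before 0; the result is
    continuous on the whole line, and later lemmas carry no domain. *)
Lemma continuous_clamp0 (V : normedModType R) (x : R -> V) :
  (forall t, 0 < t -> {for t, continuous x}) -> x @ 0^'+ --> x 0 ->
  continuous (fun t => x (Num.max 0 t)).
Proof.
move=> xc x0 t; have [t0|t0|->] := ltgtP t 0.
- rewrite /continuous_at (max_idPl (ltW t0)); apply: cvg_near_cst; near=> s.
  by rewrite (max_idPl _) // ltW //; near: s; exact: lt_nbhsl.
- rewrite /continuous_at (max_idPr (ltW t0)).
  apply: cvg_trans (xc t t0); apply: near_eq_cvg; near=> s.
  by rewrite (max_idPr _) // ltW //; near: s; exact: lt_nbhsr.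
- apply/left_right_continuousP; rewrite maxxx; split.
    by apply: cvg_near_cst; near=> s; rewrite (max_idPl _).
  by apply: cvg_trans x0; apply: near_eq_cvg; near=> s; rewrite (max_idPr _).
Unshelve. all: by end_near. Qed.

Lemma continuous_clamp0_within (V : normedModType R) (x : R -> V) :
  {within `[0, +oo[, continuous x} -> continuous (fun t => x (Num.max 0 t)).
Proof.
move=> /continuous_within_itvcyP[xc x0]; apply: continuous_clamp0 => // t t0.
by apply: xc; rewrite in_itv /= t0.
Qed.

Lemma is_derive_clamp0 (V : normedModType R) (x : R -> V) t w : 0 < t ->
  is_derive t 1 x w -> is_derive t 1 (fun t => x (Num.max 0 t)) w.
Proof.
move=> t0; apply: near_eq_is_derive; near=> s.
by rewrite (max_idPr _) // ltW //; near: s; exact: lt_nbhsr.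
Unshelve. all: by end_near. Qed.

(** The mean value inequality with exceptional points: by induction on [s], the interval is cut at
    each point that lies inside it. *)
Lemma slope_le h a b c (s : seq R) : a <= b -> continuous h ->
  (forall t, a < t -> t < b -> t \notin s -> exists2 dh, is_derive t 1 h dh & dh <= c) ->
  h b - h a <= c * (b - a).
Proof.
move=> + hc; elim: s a b => [|r s IH] a b ab dh.
  move: ab; rewrite le_eqVlt => /orP[/eqP ->|ab]; first by rewrite !subrr mulr0.
  have dh' t : t \in `]a, b[ -> is_derive t 1 h ('D_1 h t) /\ 'D_1 h t <= c.
    rewrite in_itv /= => /andP[ta tb]; have [d [hd <-] dc] := dh t ta tb isT.
    by split => //; split.
  have [t tab ->] := MVT ab (fun t tab => (dh' t tab).1) (continuous_subspaceT hc).
  by rewrite ler_wpM2r ?subr_ge0 ?(ltW ab) //; have [] := dh' t tab.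
have [/andP[ar rb]|rab] := boolP (a < r < b).
  have -> : h b - h a = (h b - h r) + (h r - h a) by ring.
  have -> : c * (b - a) = c * (b - r) + c * (r - a) by ring.
  apply: lerD; apply: IH; rewrite ?ltW // => t ta tb ts; apply: dh; try lra.
    by rewrite inE negb_or ts andbT gt_eqF.
  by rewrite inE negb_or ts andbT lt_eqF.
apply: IH => // t ta tb ts; apply: dh => //; rewrite inE negb_or ts andbT.
by apply: contra rab => /eqP <-; rewrite ta.
Qed.

Lemma last_time_below h a b m : a <= b -> continuous h -> h a <= m ->
  exists t0, [/\ a <= t0, t0 <= b, h t0 <= m & forall t, t0 < t -> t <= b -> m < h t].
Proof.
move=> ab hc ham; pose K := `[a, b] `&` [set t | h t <= m].
have Kc : compact K.
  apply: (@subclosed_compact _ _ `[a, b]); last by move=> ? [].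
    apply: closedI; first exact: itv_closed.
    exact: (closed_comp (fun t _ => hc t) (@closed_le _ _)).
  exact: segment_compact.
have K0 : K !=set0 by exists a; split => //=; rewrite in_itv /= lexx.
have [t0] := compact_EVT_max K0 Kc (continuous_subspaceT (fun t => cvg_id)).
rewrite inE => -[/itvP t0ab ht0] t0max; have at0 : a <= t0 by rewrite t0ab.
have t0b : t0 <= b by rewrite t0ab.
exists t0; split=> // t t0t tb; rewrite ltNge; apply/negP => ht.
have : t <= t0 by apply: t0max; rewrite inE; split => //=; rewrite in_itv /= tb andbT; lra.
by rewrite leNgt t0t.
Qed.

(** The exceptional set depends on the horizon [b], since an input may have infinitely many jumps in
    total. *)
Definition derivative_le h c (A : set R) : Prop := forall b, exists s : seq R,
  forall t, 0 < t -> t < b -> t \notin s -> A t -> exists2 dh, is_derive t 1 h dh & dh <= c.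

(** Either [h] stays above [m] on [[0, t]] and decreases at rate [c] throughout, or it cannot have
    risen above [m] since the last time it was at most [m]. *)
Lemma decay_bound h m c t : 0 <= c -> 0 <= t -> continuous h ->
  derivative_le h (- c) [set t | m < h t] -> h t <= Num.max m (h 0 - c * t).
Proof.
move=> c0 t0 hc /(_ t)[s dh]; rewrite le_max; have [//|hm] := leP (h t) m.
have [[r /andP[r0 rt] hr]|nr] := pselect (exists2 r, 0 <= r <= t & h r <= m).
  have [t1 [rt1 t1t ht1 hgt]] := last_time_below rt hc hr.
  have : h t - h t1 <= - c * (t - t1).
    apply: (slope_le (s := s)) => // q t1q qt qs; apply: dh => //; first lra.
    by apply: hgt => //; exact: ltW.
  have : 0 <= c * (t - t1) by rewrite mulr_ge0 // subr_ge0.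
  move=> H1 H2; suff /(lt_le_trans hm) : h t <= m by rewrite ltxx.
  by move: H2; rewrite mulNr; lra.
have : h t - h 0 <= - c * (t - 0).
  apply: (slope_le (s := s)) => // q q0 qt qs; apply: dh => //=.
  by rewrite ltNge; apply/negP => hq; apply: nr; exists q => //; rewrite !ltW.
by rewrite subr0 mulNr; lra.
Qed.

(** By continuity [h] cannot jump over the strip between [m] and [m']: just after the last time
    below [m] it lies in the strip, where it does not grow. Hence no estimate is required above
    [m']. *)
Lemma barrier h m m' t : 0 <= t -> continuous h -> h 0 <= m -> m < m' ->
  derivative_le h 0 [set t | m < h t < m'] -> h t <= m.
Proof.
move=> t0 hc h0 mm' /(_ t)[s dh].
have [t1 [t10 t1t ht1 hgt]] := last_time_below t0 hc h0.
move: t1t; rewrite le_eqVlt => /orP[/eqP <- //|t1t].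
have : \forall u \near t1, h u < m'.
  by apply: (cvgr_lt _ (hc t1)); exact: le_lt_trans ht1 mm'.
move=> /nbhs_ballP[e /= e0 he].
pose u := Num.min t (t1 + e / 2).
have t1u : t1 < u by rewrite /u lt_min t1t ltrDl divr_gt0.
have ut : u <= t by rewrite /u ge_min lexx.
have : h u - h t1 <= 0 * (u - t1).
  apply: (slope_le (s := s)) => //; first exact: ltW.
  move=> q t1q qu qs; have qt : q < t by exact: lt_le_trans qu ut.
  apply: dh => //=; first exact: le_lt_trans t1q.
  rewrite hgt ?(ltW qt) //=; apply: he; rewrite -ball_normE /=.
  have ue : u <= t1 + e / 2 by rewrite /u ge_min lexx orbT.
  by rewrite ltr_norml; apply/andP; split; lra.
rewrite mul0r subr_le0 => hu; have := hgt u t1u ut.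
by rewrite ltNge (le_trans hu ht1).
Qed.

End DifferentialInequalities.

(** * Antiderivatives of inputs with jumps *)

Section Antiderivatives.
Context {R : realType}.

Lemma measurable_fun_finite_discontinuities (v : R -> R) (D : set R) (s : seq R) :
  open D -> (forall t, D t -> t \notin s -> {for t, continuous v}) -> measurable_fun D v.
Proof.
elim: s D => [|r s IH] D oD vc.
  by apply: measurable_realfun.open_continuous_measurable_fun => // t /set_mem Dt; exact: vc.
have mD' : measurable_fun (D `\ r) v.
  apply: IH => [|t [Dt /= tr] ts].
    by rewrite setDE -(set_itv1 r); apply: openI => //; apply: closed_openC; exact: itv_closed.
  by apply: vc => //; rewrite inE negb_or ts andbT; exact/eqP.
have [rD|rD] := pselect (D r); last first.
  have <- : D `\ r = D; last exact: mD'.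
  by apply/seteqP; split=> [t []//|t Dt]; split=> // tr; apply: rD; rewrite -tr.
have -> : D = [set r] `|` D `\ r by rewrite setD1K.
apply/measurable_funU; first exact: measurable_set1.
  by apply: measurableD; [exact: measurable_realfun.open_measurable|exact: measurable_set1].
by split=> //; exact: measurable_fun_set1.
Qed.

Definition finitely_discontinuous (V : normedModType R) (v : R -> V) : Prop :=
  forall T : R, exists s : seq R,
    forall t : R, 0 < t -> t < T -> t \notin s -> {for t, continuous v}.

(** The Lebesgue integral of [v] from 0: boundedness makes it exist, and the fundamental theorem of
    calculus applies at every continuity point. *)
Lemma antiderivative (v : R -> R) B :
  finitely_discontinuous v -> (forall t, 0 <= t -> `|v t| <= B) ->
  exists D : R -> R, [/\ continuous D, D 0 = 0
    & forall t, 0 < t -> {for t, continuous v} -> is_derive t 1 D (v t)].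
Proof.
move=> vd vB; pose mu := @lebesgue_measure R.
have vi T : 0 < T -> mu.-integrable `[0, T] (EFin \o v).
  move=> T0; apply: measurable_bounded_integrable.
  - exact: measurable_itv.
  - by apply: compact_finite_measure; exact: segment_compact.
  - apply/measurable_realfun.measurable_fun_itv_bndo_bndcP.
    apply/measurable_realfun.measurable_fun_itv_obnd_cbndP.
    have [s vs] := vd T; apply: (measurable_fun_finite_discontinuities (s := s)).
      exact: interval_open.
    by move=> t /=; rewrite in_itv /= => /andP[t0 tT]; exact: vs.
  - exists B; split; first exact: num_real.
    move=> M BM t /=; rewrite in_itv /= => /andP[t0 _].
    by apply: le_trans (ltW BM); exact: vB.
pose D t := (\int[mu]_(s in `[0, t]) v s)%R.
have D0 : D 0 = 0 by rewrite /D set_itv1 Rintegral_set1.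
have Dc t : 0 < t -> {for t, continuous D} /\ D @ 0^'+ --> D 0.
  move=> t0; have t1 : 0 < t + 1 by rewrite ltr_pwDr // ltW.
  have := parameterized_integral_continuous (ltW t1) (vi _ t1).
  move=> /(continuous_within_itvP _ t1)[cD c0 _]; split=> //.
  by apply: cD; rewrite in_itv /= t0 ltrDl ltr01.
exists (fun t => D (Num.max 0 t)); split.
- apply: continuous_clamp0 => [t t0|]; first by have [] := Dc t t0.
  by have [] := Dc 1 ltr01.
- by rewrite maxxx.
- move=> t t0 vt; apply: is_derive_clamp0 => //.
  have t1 : t < t + 1 by rewrite ltrDl.
  have [dD <-] := continuous_FTC1_closed t1 (vi _ (lt_trans t0 t1)) t0 vt.
  by rewrite derive1E; split.
Qed.

Lemma continuous_cV (T : topologicalType) k (x : T -> 'cV[R]_k) :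
  (forall i, continuous (fun t => x t i ord0)) -> continuous x.
Proof.
move=> xc t; apply/cvgrPdist_lt => e e0; near=> s.
apply: le_lt_trans (_ : e / 2 < e); last lra.
apply: normr_mx_le => [|i j]; first by rewrite divr_ge0 // ltW.
rewrite ord1 !mxE; move: i; near: s; apply: filter_forall => i.
have e20 : 0 < e / 2 by rewrite divr_gt0.
by have /cvgrPdist_le/(_ _ e20) := xc i t.
Unshelve. all: by end_near. Qed.

Lemma continuous_cV_coord (T : topologicalType) k (x : T -> 'cV[R]_k) (t : T) i :
  {for t, continuous x} -> {for t, continuous (fun t => x t i ord0)}.
Proof.
move=> xt; apply: (continuous_comp (f := x) (g := fun A : 'cV[R]_k => A i ord0)) => //.
exact: coord_continuous.
Qed.

Lemma antiderivative_cV k (v : R -> 'cV[R]_k) B :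
  finitely_discontinuous v -> (forall t, 0 <= t -> `|v t| <= B) ->
  exists D : R -> 'cV[R]_k, [/\ continuous D, D 0 = 0
    & forall t, 0 < t -> {for t, continuous v} -> is_derive t 1 D (v t)].
Proof.
move=> vd vB.
have /choice[D DP] : forall i, exists D : R -> R, [/\ continuous D, D 0 = 0
    & forall t, 0 < t -> {for t, continuous (fun t => v t i ord0)} ->
      is_derive t 1 D (v t i ord0)].
  move=> i; apply: (@antiderivative (fun t => v t i ord0) B) => [T|t t0].
    have [s vs] := vd T; exists s => t t0 tT ts.
    by apply: continuous_cV_coord; exact: vs.
  by apply: le_trans (vB t t0); exact: normr_coord.
exists (fun t => \col_i D i t); split.
- apply: continuous_cV => i; under eq_fun do rewrite mxE.
  by have [] := DP i.
- by apply/colP => i; rewrite !mxE; have [] := DP i.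
- move=> t t0 vt; apply: is_derive_cV => i; under eq_fun do rewrite mxE.
  by have [_ _] := DP i; apply => //; exact: continuous_cV_coord.
Qed.

End Antiderivatives.

(** * Growth comparison and geometric limits *)

Section Existence.
Context {R : realType}.

(** In the max norm it suffices to bound [e h_i] by [w] for [e = 1] and [e = -1], which is a scalar
    mean value estimate. *)
Lemma growth_le k (h : R -> 'cV[R]_k) (w : R -> R) (t : R) : 0 <= t ->
  continuous h -> continuous w -> `|h 0| <= w 0 ->
  (forall t : R, 0 < t -> exists dh dw,
     [/\ is_derive t 1 h dh, is_derive t 1 w dw & `|dh| <= dw]) ->
  `|h t| <= w t.
Proof.
move=> t0 hc wc h0 dhw.
have coord (e : R) i : `|e| <= 1 -> e * h t i ord0 <= w t.
  move=> e1; have ec : continuous (fun t => e * h t i ord0 - w t).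
    move=> u; have hcu : {for u, continuous (fun t : R => h t i ord0)}.
      exact: (continuous_cV_coord (hc u)).
    exact: (cvgB (cvgM (cvg_cst e) hcu) (wc u)).
  have : (e * h t i ord0 - w t) - (e * h 0 i ord0 - w 0) <= 0 * (t - 0).
    apply: (slope_le (h := fun t => e * h t i ord0 - w t) (s := [::])) => // u u0 _ _.
    have [dh [dw [hd wd dhdw]]] := dhw u u0; have hid := is_derive_coord hd i.
    exists (e * dh i ord0 - dw).
      have ed : is_derive u 1 (e *: (fun t => h t i ord0)) (e *: dh i ord0) by exact: is_deriveZ.
      exact: (is_deriveB ed wd).
    rewrite subr_le0; apply: le_trans dhdw; apply: le_trans (ler_norm _) _.
    rewrite normrM -[leRHS]mul1r; apply: ler_pM => //; exact: normr_coord.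
  have : e * h 0 i ord0 <= w 0.
    apply: le_trans h0; apply: le_trans (ler_norm _) _.
    rewrite normrM -[leRHS]mul1r; apply: ler_pM => //; exact: normr_coord.
  by rewrite mul0r; lra.
apply: normr_mx_le => [|i j].
  (* [0 <= w t] needs its own argument: for [k = 0] there is no coordinate to derive it from. *)
  have : - w t - - w 0 <= 0 * (t - 0).
    apply: (slope_le (h := fun t => - w t) (s := [::])) => // [u|u u0 _ _].
      by apply: cvgN; exact: wc.
    have [dh [dw [_ wd dhdw]]] := dhw u u0.
    by exists (- dw); rewrite ?oppr_le0; [exact: is_deriveN|exact: le_trans dhdw].
  by have := le_trans (normr_ge0 _) h0; rewrite mul0r; lra.
rewrite ord1 ler_norml; have := coord 1 i; have := coord (- 1) i.
by rewrite normrN normr1 mul1r mulN1r lexx lerNl => -> // ->.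
Qed.

(** Nested intervals: [q k] is the tail sum of the step bounds, so [u k - q k] increases,
    [u k + q k] decreases, and the supremum of the former lies in every interval. *)
Lemma geometric_limit (u : nat -> R) K :
  (forall k, `|u k.+1 - u k| <= K * 2^-1 ^+ k) ->
  exists l, forall k, `|u k - l| <= 2 * K * 2^-1 ^+ k.
Proof.
move=> uK; have K0 : 0 <= K by have := uK 0%N; rewrite expr0 mulr1; exact: le_trans.
pose q k : R := 2 * K * 2^-1 ^+ k.
have qS k : q k.+1 = K * 2^-1 ^+ k by rewrite /q exprS; field.
have qE k : q k = 2 * q k.+1 by rewrite qS /q; ring.
have q0 k : 0 <= q k by rewrite /q !mulr_ge0 // exprn_ge0.
have step k : q k.+1 - q k <= u k.+1 - u k <= q k - q k.+1.
  have := uK k; rewrite -qS ler_norml (qE k); lra.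
have inc j d : u j - q j <= u (j + d)%N - q (j + d)%N.
  elim: d => [|d IH]; first by rewrite addn0.
  by rewrite addnS; have := step (j + d)%N; lra.
have dec j d : u (j + d)%N + q (j + d)%N <= u j + q j.
  elim: d => [|d IH]; first by rewrite addn0.
  by rewrite addnS; have := step (j + d)%N; lra.
have cross j i : u j - q j <= u i + q i.
  have := inc j i; have := dec i j; rewrite addnC; have := q0 (j + i)%N; lra.
pose A := range (fun k => u k - q k).
have supA : has_sup A.
  by split; [exists (u 0%N - q 0%N); exists 0%N|exists (u 0%N + q 0%N) => _ [j _ <-]].
exists (sup A) => k; rewrite -/(q k) ler_norml.
have : u k - q k <= sup A by apply: sup_upper_bound => //; exists k.
have : sup A <= u k + q k by apply: ge_sup; [case: supA|move=> _ [j _ <-]].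
lra.
Qed.

Lemma le_of_geometric (a b K : R) : (forall k, a <= b + K * 2^-1 ^+ k) -> a <= b.
Proof.
move=> H; have : (fun k => b + K * 2^-1 ^+ k) @ \oo --> b + K * 0.
  apply: cvgD; first exact: cvg_cst.
  apply: cvgM; first exact: cvg_cst.
  by apply: cvg_expr; rewrite ger0_norm //; lra.
rewrite mulr0 addr0 => Hb; apply: (cvgr_to_ge Hb); exact: nearW.
Qed.

End Existence.

(** * Picard iteration for a bounded, globally Lipschitz field *)

Section GlobalSolutions.
Context {R : realType} {n : nat}.
Variables (f : 'cV[R]_n -> 'cV[R]_n) (L B : R) (D : R -> 'cV[R]_n) (x0 : 'cV[R]_n).
Hypotheses (L0 : 0 < L) (B0 : 0 <= B).
Hypothesis f_lip : forall x y, `|f x - f y| <= L * `|x - y|.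
Hypothesis f_le : forall x, `|f x| <= B.
Hypothesis Dc : continuous D.

Let f_continuous : continuous f.
Proof.
move=> x; have Fx : Filter (nbhs x) by exact: nbhs_filter.
apply/cvgrPdist_lt => e e0.
have d0 : 0 < e / L by rewrite divr_gt0.
apply: (filterS _ (nbhsx_ballx x _ d0)) => y; rewrite -ball_normE /= => xy.
by apply: le_lt_trans (f_lip _ _) _; rewrite mulrC -ltr_pdivlMr.
Qed.

(** Continuity of [y] is a premise inside the existential so that [choice] yields an operator on all
    functions. *)
Let picard_step (y : R -> 'cV[R]_n) : exists z : R -> 'cV[R]_n, continuous y ->
  [/\ continuous z, z 0 = x0
    & forall t : R, 0 < t -> is_derive t 1 z (f (y t + D t))].
Proof.
have [yc|nyc] := pselect (continuous y); last by exists y.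
have vc : continuous (fun t => f (y t + D t)).
  move=> t; apply: (continuous_comp (f := fun t => y t + D t) (g := f)); last exact: f_continuous.
  by apply: cvgD; [exact: yc|exact: Dc].
have [||z [zc z0 dz]] := @antiderivative_cV R n (fun t => f (y t + D t)) B.
- by move=> T; exists [::] => t _ _ _; exact: vc.
- by move=> t _; exact: f_le.
exists (fun t => x0 + z t); split.
- by move=> t; apply: cvgD; [exact: cvg_cst|exact: zc].
- by rewrite z0 addr0.
- move=> t t0; rewrite -[f _]add0r.
  exact: (is_deriveD (is_derive_cst x0 t 1) (dz t t0 (vc t))).
Qed.

(* [z + D] then solves [x' = f x + D'], and only the Lipschitz part is iterated.
   Bielecki's weight [expR (2 L t)] makes the Picard map a contraction by [1/2]. *)
Lemma lipschitz_ode_solution : exists z : R -> 'cV[R]_n,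
  [/\ continuous z, z 0 = x0
    & forall t : R, 0 < t -> is_derive t 1 z (f (z t + D t))].
Proof.
have [Phi PhiP] := choice picard_step.
pose y := fix y k := if k is k'.+1 then Phi (y k') else (fun=> x0).
have yc k : continuous (y k).
  elim: k => [|k IH] /=; first by move=> t; exact: cvg_cst.
  by have [] := PhiP _ IH.
have y0 k : y k 0 = x0.
  by case: k => //= k; have [] := PhiP _ (yc k).
have dy k (t : R) : 0 < t -> is_derive t 1 (y k.+1) (f (y k t + D t)).
  by have [_ _] := PhiP _ (yc k); apply.
pose w c (t : R) := c * expR (2 * L * t).
have dw (c t : R) : is_derive t 1 (w c) (2 * L * w c t).
  have dl : is_derive t 1 (fun t : R => 2 * L * t) (2 * L).
    have := is_deriveZ (2 * L) (is_derive_id t (1 : R)).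
    by move=> dl; apply: (is_derive_eq dl); rewrite -[_ *: _]/(_ * _) mulr1.
  have de := @is_derive1_comp R expR (fun t : R => 2 * L * t) t _ _ (is_derive_expR _) dl.
  apply: (is_derive_eq (is_deriveZ c de)).
  by rewrite -[_ *: _]/(_ * _) /w; ring.
have wc c : continuous (w c).
  by move=> t; apply/differentiable_continuous/derivable1_diffP; case: (dw c t).
have w_ge0 (c t : R) : 0 <= c -> 0 <= w c t by move=> c0; rewrite mulr_ge0 // expR_ge0.
(* The derivative of [w C] is then [B expR (2 L t)], at least [B], which starts the induction in
   [ydiff]. *)
pose C := B / (2 * L).
have C0 : 0 <= C by rewrite divr_ge0 // mulr_ge0 // ltW.
have q0 k : 0 <= (2^-1 : R) ^+ k by rewrite exprn_ge0.
have Cq k : 0 <= C * 2^-1 ^+ k by rewrite mulr_ge0.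
(* If [a] and [b] differ by at most [w (2 c)], the derivatives of their images differ by at most
   [L w (2 c) = 2 L w c], exactly the derivative of [w c]. *)
have contract (a b a' b' : R -> 'cV[R]_n) (c t : R) : 0 <= t -> 0 <= c ->
    continuous a' -> continuous b' -> a' 0 = b' 0 ->
    (forall t : R, 0 < t -> is_derive t 1 a' (f (a t + D t))) ->
    (forall t : R, 0 < t -> is_derive t 1 b' (f (b t + D t))) ->
    (forall t : R, 0 <= t -> `|a t - b t| <= w (2 * c) t) ->
    `|a' t - b' t| <= w c t.
  move=> t0 c0 ac bc ab0 da db abw.
  apply: (growth_le (h := fun t => a' t - b' t)) => //.
  - by move=> u; apply: cvgB; [exact: ac|exact: bc].
  - by rewrite ab0 subrr normr0 w_ge0.
  - move=> u u0; exists (f (a u + D u) - f (b u + D u)), (2 * L * w c u); split=> //.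
      exact: (is_deriveB (da u u0) (db u u0)).
    apply: le_trans (f_lip _ _) _; rewrite opprD addrACA subrr addr0 /w.
    apply: le_trans (ler_wpM2l (ltW L0) (abw u (ltW u0))) _.
    by rewrite le_eqVlt /w; apply/orP; left; apply/eqP; ring.
have ydiff k (t : R) : 0 <= t -> `|y k.+1 t - y k t| <= w (C * 2^-1 ^+ k) t.
  elim: k t => [|k IH] t t0.
    apply: (growth_le (h := fun t => y 1%N t - y 0%N t)) => //.
    - by move=> u; apply: cvgB; exact: yc.
    - by rewrite !y0 subrr normr0 w_ge0.
    - move=> u u0; exists (f (y 0%N u + D u) - 0), (2 * L * w (C * 2^-1 ^+ 0) u).
      split=> //; first exact: (is_deriveB (dy 0%N u u0) (is_derive_cst x0 u 1)).
      rewrite subr0; apply: le_trans (f_le _) _; rewrite /w expr0 mulr1.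
      have -> : 2 * L * (C * expR (2 * L * u)) = B * expR (2 * L * u).
        by rewrite /C; field; rewrite gt_eqF.
      rewrite -[leLHS]mulr1; apply: ler_wpM2l => //.
      by rewrite -expR0 ler_expR !mulr_ge0 // ltW.
  apply: (contract (y k.+1) (y k) (y k.+2) (y k.+1)) => //; try exact: yc.
  - by rewrite !y0.
  - move=> u u0; apply: le_trans (IH u u0) _.
    by rewrite le_eqVlt exprS /w; apply/orP; left; apply/eqP; field.
have ylim (t : R) : exists l : 'cV[R]_n, forall k,
    `|y k (Num.max 0 t) - l| <= w (2 * C * 2^-1 ^+ k) (Num.max 0 t).
  set u := Num.max 0 t; have u0 : 0 <= u by rewrite le_max lexx.
  have /choice[l lP] : forall i, exists l : R, forall k,
      `|y k u i ord0 - l| <= 2 * (w C u) * 2^-1 ^+ k.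
    move=> i; apply: (geometric_limit (u := fun k => y k u i ord0)) => k.
    have := normr_coord (y k.+1 u - y k u) i ord0; rewrite !mxE => /le_trans; apply.
    apply: le_trans (ydiff k u u0) _.
    by rewrite /w mulrAC.
  exists (\col_i l i) => k; apply: normr_mx_le => [|i j].
    by rewrite w_ge0 // -mulrA mulr_ge0.
  rewrite ord1 !mxE; apply: le_trans (lP i k) _.
  by rewrite le_eqVlt /w; apply/orP; left; apply/eqP; ring.
have [z zP] := choice ylim.
(* A Lipschitz bound in time, uniform in [k], passes to the pointwise limit and makes [z]
   continuous. *)
have yLip k (s t : R) : 0 <= s -> s <= t -> `|y k t - y k s| <= B * (t - s).
  move=> s0 st; case: k => [|k].
    by rewrite subrr normr0 mulr_ge0 // subr_ge0.
  apply: normr_mx_le => [|i j]; first by rewrite mulr_ge0 // subr_ge0.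
  rewrite ord1 !mxE; have ykc : continuous (fun t : R => y k.+1 t i ord0).
    by move=> u; exact: (continuous_cV_coord (yc k.+1 u)).
  have bnd (u : R) : `|f (y k u + D u) i ord0| <= B.
    by apply: le_trans (f_le _); exact: normr_coord.
  rewrite ler_norml; apply/andP; split.
    have : - y k.+1 t i ord0 - - y k.+1 s i ord0 <= B * (t - s).
      apply: (slope_le (h := fun t => - y k.+1 t i ord0) (s := [::])) => // [u|u su _ _].
        by apply: cvgN; exact: ykc.
      have du := is_derive_coord (dy k u (le_lt_trans s0 su)) i.
      exists (- f (y k u + D u) i ord0); first exact: is_deriveN.
      by apply: le_trans (ler_norm _) _; rewrite normrN.
    lra.
  apply: (slope_le (h := fun t => y k.+1 t i ord0) (s := [::])) => // u su _ _.
  exists (f (y k u + D u) i ord0).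
    exact: (is_derive_coord (dy k u (le_lt_trans s0 su)) i).
  exact: le_trans (ler_norm _) _.
have zLip (s t : R) : `|z t - z s| <= B * `|t - s|.
  wlog st : s t / s <= t => [H|].
    by have [|/ltW] := leP s t; [exact: H|rewrite distrC [`|t - s|]distrC; exact: H].
  set s' := Num.max 0 s; set t' := Num.max 0 t.
  have s'0 : 0 <= s' by rewrite le_max lexx.
  have st' : s' <= t' by rewrite le_max2.
  have st'' : t' - s' <= t - s.
    by rewrite /s' /t'; case: (leP 0 s) => ?; case: (leP 0 t) => ?; lra.
  apply: (@le_of_geometric _ _ _ (w (2 * C) t' + w (2 * C) s')) => k.
  have -> : z t - z s = (y k t' - y k s') + ((y k s' - z s) - (y k t' - z t)).
    by apply/colP => i; rewrite !mxE; ring.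
  apply: le_trans (ler_normD _ _) _; apply: lerD.
    apply: le_trans (yLip k _ _ s'0 st') _; apply: ler_wpM2l => //.
    by apply: le_trans st'' (ler_norm _).
  apply: le_trans (ler_normB _ _) _; rewrite mulrDl addrC; apply: lerD.
    by apply: le_trans (zP t k) _; rewrite /w mulrAC.
  by apply: le_trans (zP s k) _; rewrite /w mulrAC.
have zc : continuous z.
  move=> t; apply/cvgrPdist_lt => e e0; near=> s.
  have st : `|t - s| < e / (B + 1).
    by near: s; apply: cvgr_dist_lt; [exact: cvg_id|rewrite divr_gt0 // ltr_wpDl].
  apply: le_lt_trans (zLip _ _) _.
  move: st; rewrite ltr_pdivlMr ?ltr_wpDl // mulrC; apply: le_lt_trans.
  by apply: ler_wpM2r => //; rewrite lerDl.
have [zc' z0' dz'] := PhiP z zc.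
(* The derivative of [Phi z] is known, so only the pointwise equality [Phi z t = z t] remains; both
   sides are within a geometric error of the iterate [y k.+1]. *)
exists (Phi z); split=> // t t0.
suff E : Phi z t = z t by rewrite E; exact: dz'.
have zyk k (u : R) : 0 <= u -> `|z u - y k u| <= w (2 * C * 2^-1 ^+ k) u.
  by move=> u0; have := zP u k; rewrite (max_idPr u0) distrC.
apply/eqP; rewrite -subr_eq0 -normr_le0.
apply: (@le_of_geometric _ _ _ (2 * w C t)) => k; rewrite add0r.
have -> : Phi z t - z t = (Phi z t - y k.+1 t) + (y k.+1 t - z t) by rewrite addrA subrK.
apply: le_trans (ler_normD _ _) _.
have -> : 2 * w C t * 2^-1 ^+ k = w (C * 2^-1 ^+ k) t + w (C * 2^-1 ^+ k) t.
  by rewrite /w; ring.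
apply: lerD.
  apply: (contract z (y k) (Phi z) (y k.+1)) => //; first exact: ltW.
  - by rewrite z0' y0.
  - by move=> u u0; rewrite mulrA; exact: zyk.
rewrite distrC; apply: le_trans (zyk k.+1 t (ltW t0)) _.
by rewrite le_eqVlt /w exprS; apply/orP; left; apply/eqP; field.
Unshelve. all: by end_near. Qed.

End GlobalSolutions.

(** * Saturation onto a max-norm ball *)

Section Saturation.
Context {R : realType} {n : nat}.
Implicit Types (r : R) (x y : 'cV[R]_n).

(** Truncating each coordinate suits the max norm: the map fixes the ball and is nonexpansive, so
    precomposition with it makes a field that is Lipschitz on balls bounded and globally
    Lipschitz. *)
Definition saturate r x : 'cV[R]_n := \col_i Num.max (- r) (Num.min r (x i ord0)).

Lemma saturate_le r x : 0 <= r -> `|saturate r x| <= r.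
Proof.
move=> r0; apply: normr_mx_le => // i j; rewrite mxE ler_norml le_max lexx /=.
by rewrite ge_max ge_min lexx andbT; lra.
Qed.

Lemma saturate_id r x : `|x| <= r -> saturate r x = x.
Proof.
move=> xr; apply/colP => i; rewrite mxE.
have /andP[lo hi] : - r <= x i ord0 <= r by rewrite -ler_norml (le_trans _ xr) ?normr_coord.
by rewrite (min_idPr hi) (max_idPr lo).
Qed.

Lemma saturate_lip r x y : `|saturate r x - saturate r y| <= `|x - y|.
Proof.
apply: normr_mx_le => // i j; rewrite ord1 !mxE.
have := normr_coord (x - y) i ord0; rewrite !mxE; apply: le_trans.
have minl (a b : R) : `|Num.min r a - Num.min r b| <= `|a - b|.
  case: (leP r a) => ra; case: (leP r b) => rb //.
  - by rewrite subrr normr0.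
  - by rewrite !ger0_norm; lra.
  - by rewrite !ler0_norm; lra.
apply: le_trans (minl _ _); move: (Num.min r _) (Num.min r _) => a b.
case: (leP (- r) a) => ra; case: (leP (- r) b) => rb //.
- by rewrite !ler0_norm; lra.
- by rewrite !ger0_norm; lra.
- by rewrite subrr normr0.
Qed.

End Saturation.

(** * Input-to-state stability from a dissipation inequality *)

Section LyapunovISS.
Context {R : realType} {n : nat}.
Variables (F : 'cV[R]_n -> 'cV[R]_n) (V b sg : 'cV[R]_n -> R).
Hypotheses (F_lip : lipschitz_on_balls_mx F) (F0 : F 0 = 0).
Hypotheses (Vc : continuous V) (V_pd : positive_definite V) (V_ru : radially_unbounded V).
Hypotheses (bc : continuous b) (b_pd : positive_definite b) (b_ru : radially_unbounded b).
Hypotheses (sgc : continuous sg) (sg0 : sg 0 = 0).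
Hypothesis dissipation : forall (x : R -> 'cV[R]_n) (t : R) (d : 'cV[R]_n),
  is_derive t 1 x (F (x t) + d) ->
  exists2 dV, is_derive t 1 (fun s => V (x s)) dV & dV <= - b (x t) + sg d.

Let V_ge0 x : 0 <= V x.
Proof. by case: V_pd => V0 Vpos; have [->|/Vpos/ltW//] := eqVneq x 0; rewrite V0. Qed.

(** The factor 2 splits [b]: one half absorbs the disturbance term, the other provides the rate
    [s]. *)
Lemma lyapunov_decrease kappa sigma (M s : R) (x : R -> 'cV[R]_n) (t : R) (d : 'cV[R]_n) :
  strict_gain kappa -> (forall y, V y <= kappa (b y)) ->
  strict_gain sigma -> (forall y, sg y <= sigma (enorm y)) ->
  enorm d <= M -> 0 <= s -> kappa (2 * Num.max s (sigma M)) < V (x t) ->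
  is_derive t 1 x (F (x t) + d) ->
  exists2 dV, is_derive t 1 (fun s => V (x s)) dV & dV <= - s.
Proof.
move=> kK Vk sK sgs dM s0 Vx /dissipation[dV dVx dVle]; exists dV => //.
have bx : 2 * Num.max s (sigma M) < b (x t).
  rewrite ltNge; apply/negP => /(strict_gain_le kK) /(le_trans (Vk _)).
  by rewrite leNgt Vx.
have sgd : sg d <= sigma M by apply: le_trans (sgs d) _; exact: strict_gain_le sK _ _ dM.
have ms : s <= Num.max s (sigma M) by rewrite le_max lexx.
have mM : sigma M <= Num.max s (sigma M) by rewrite le_max lexx orbT.
by apply: le_trans dVle _; lra.
Qed.

Lemma enorm_le_sup (v : R -> 'cV[R]_n) (t : R) : bounded_input v -> 0 <= t ->
  enorm (v t) <= sup [set enorm (v s) | s in [set s | 0 <= s]].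
Proof.
move=> [M vM] t0; apply: sup_upper_bound; last by exists t.
by split; [exists (enorm (v 0)); exists 0 => //=|exists M => _ [s s0 <-]; exact: vM].
Qed.

Lemma solution_bound kappa sigma (M : R) (x0 : 'cV[R]_n) (v x : R -> 'cV[R]_n) (t : R) :
  strict_gain kappa -> (forall y, V y <= kappa (b y)) ->
  strict_gain sigma -> (forall y, sg y <= sigma (enorm y)) ->
  finitely_discontinuous v -> (forall t : R, 0 <= t -> enorm (v t) <= M) ->
  is_solution (fun x d => F x + d) v x0 x -> 0 <= t ->
  V (x t) <= kappa (2 * ((1 + t)^-1 * V x0)) + (1 + t)^-1 * V x0 + kappa (2 * sigma M).
Proof.
move=> kK Vk sK sgs vd vM [x_0 xc dx] t0.
(* This [s] balances the two terms of [decay_bound]: [V x0 - s * t = s]. *)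
set s := (1 + t)^-1 * V x0; have t1 : 0 < 1 + t by lra.
have s0 : 0 <= s by rewrite mulr_ge0 // invr_ge0 ltW.
have M0 : 0 <= M by apply: le_trans (vM 0 (lexx _)); exact: enorm_ge0.
have sM0 : 0 <= sigma M by exact: strict_gain_ge0.
pose m := kappa (2 * Num.max s (sigma M)).
have hc : continuous (fun t : R => V (x (Num.max 0 t))).
  move=> u; apply: (continuous_comp (f := fun t : R => x (Num.max 0 t)) (g := V)); last exact: Vc.
  exact: continuous_clamp0_within.
have := @decay_bound R (fun t : R => V (x (Num.max 0 t))) m s t s0 t0 hc.
rewrite maxxx (max_idPr t0) x_0 => /(_ _)/le_trans; apply.
  move=> T; have [q vq] := vd T; exists q => u u0 uT uq /= Vu.
  rewrite (max_idPr (ltW u0)) in Vu.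
  have [dV dVx dVle] := lyapunov_decrease kK Vk sK sgs (vM u (ltW u0)) s0 Vu
    (dx u u0 (vq u u0 uT uq)).
  by exists dV => //; exact: (is_derive_clamp0 (x := fun s => V (x s))).
have k1 : 0 <= kappa (2 * s) by rewrite strict_gain_ge0 // mulr_ge0.
have k2 : 0 <= kappa (2 * sigma M) by rewrite strict_gain_ge0 // mulr_ge0.
rewrite ge_max; apply/andP; split.
  rewrite /m; case: (leP s (sigma M)) => _; lra.
have -> : V x0 - s * t = s by rewrite /s; field; rewrite gt_eqF.
lra.
Qed.

Lemma solution_exists (x0 : 'cV[R]_n) (v : R -> 'cV[R]_n) :
  finitely_discontinuous v -> bounded_input v ->
  exists x, is_solution (fun x d => F x + d) v x0 x.
Proof.
move=> vd [M vM].
have [kappa kK Vk] := strict_gain_dominates_cV Vc V_pd.1 bc b_pd b_ru.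
have [sigma sK sgs] := strict_gain_dominates_cV sgc sg0
  (@enorm_continuous R n) enorm_posdef enorm_unbounded.
have [chi cK chiV] := strict_gain_dominates_cV (@enorm_continuous R n) enorm0 Vc V_pd V_ru.
(* Above the second level [V] does not grow (rate [s = 0]), so [m] should bound it along the
   trajectory. The radius [r] covers [V <= m + 1], which leaves a strip of width 1 for [barrier]. *)
pose m := Num.max (V x0) (kappa (2 * Num.max 0 (sigma M))).
have m0 : 0 <= m by rewrite le_max V_ge0.
pose r := chi (m + 1); have r0 : 0 <= r by apply: strict_gain_ge0 => //; lra.
have Vr x : V x <= m + 1 -> `|x| <= r.
  move=> Vx; apply: le_trans (normr_le_enorm _) _; apply: le_trans (chiV x) _.
  exact: strict_gain_le cK _ _ Vx.
have [L L0 FL] := lipschitz_on_balls_norm r F_lip.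
pose f x := F (saturate r x).
have f_lip x y : `|f x - f y| <= (L + 1) * `|x - y|.
  apply: le_trans (FL _ _ (saturate_le _ r0) (saturate_le _ r0)) _.
  by apply: ler_pM => //; [rewrite lerDl|exact: saturate_lip].
have f_le x : `|f x| <= L * r.
  have := FL (saturate r x) 0 (saturate_le _ r0); rewrite normr0 => /(_ r0).
  rewrite F0 !subr0 => /le_trans; apply; apply: ler_wpM2l => //; exact: saturate_le.
have vB (t : R) : 0 <= t -> `|v t| <= M.
  by move=> t0; apply: le_trans (vM t t0); exact: normr_le_enorm.
have [D [Dc D0 dD]] := antiderivative_cV vd vB.
have LV1 : 0 < L + 1 by lra.
have [z [zc z0 dz]] := lipschitz_ode_solution x0 LV1 (mulr_ge0 L0 r0) f_lip f_le Dc.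
pose x (t : R) := z t + D t.
have xc : continuous x by move=> t; apply: cvgD; [exact: zc|exact: Dc].
have x_0 : x 0 = x0 by rewrite /x z0 D0 addr0.
have dx (t : R) : 0 < t -> {for t, continuous v} -> is_derive t 1 x (f (x t) + v t).
  by move=> t0 vt; exact: (is_deriveD (dz t t0) (dD t t0 vt)).
(* On the strip [m < V < m + 1] the state lies in the ball of radius [r], where the saturated and
   the true field agree, so the dissipation hypothesis applies. *)
have Vm (t : R) : 0 <= t -> V (x t) <= m.
  move=> t0; apply: (@barrier R (fun t => V (x t)) m (m + 1)) => //.
  - by move=> u; apply: (continuous_comp (f := x) (g := V)); [exact: xc|exact: Vc].
  - by rewrite x_0 le_max lexx.
  - by rewrite ltrDl.
  - move=> T; have [q vq] := vd T; exists q => u u0 uT uq /= /andP[Vu Vu'].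
    have dxu := dx u u0 (vq u u0 uT uq).
    rewrite /f saturate_id in dxu; last by apply: Vr; exact: ltW.
    rewrite -oppr0; apply: (lyapunov_decrease kK Vk sK sgs (vM u (ltW u0))) => //.
    by apply: le_lt_trans Vu; rewrite le_max lexx orbT.
exists x; split=> //; first exact: continuous_subspaceT.
move=> t t0 vt; have := dx t t0 vt; rewrite /f saturate_id //.
by apply: Vr; apply: le_trans (Vm t (ltW t0)) _; lra.
Qed.

Lemma class_KL_of_gain theta alpha : strict_gain theta -> strict_gain alpha ->
  class_KL (fun r t : R => theta ((1 + t)^-1 * alpha r)).
Proof.
move=> tK aK; have [tc ti th0] := tK; have [ac ai a0] := aK; split.
- apply: continuous_in_subspaceT => z /set_mem[/= _]; rewrite in_itv /= andbT => z2.
  apply: (continuous_comp (f := fun z : R * R => (1 + z.2)^-1 * alpha z.1)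
    (g := theta)); last exact: tc.
  apply: cvgM; last by apply: (continuous_comp (f := fst) (g := alpha)); [exact: cvg_fst|exact: ac].
  apply: cvgV; first by rewrite gt_eqF //; lra.
  by apply: cvgD; [exact: cvg_cst|exact: cvg_snd].
- move=> s s0; apply: strict_gain_class_K.
  have c0 : 0 < (1 + s)^-1 by rewrite invr_gt0; lra.
  exact: strict_gain_comp tK (strict_gain_comp (strict_gainZ c0) aK).
- move=> r r0 s t; rewrite !in_itv /= !andbT => s0 t0 st.
  apply: (strict_gain_le tK); apply: ler_wpM2r; first exact: strict_gain_ge0.
  by rewrite lef_pV2 ?posrE; lra.
- move=> r r0; rewrite -th0.
  apply: (cvg_comp (fun s : R => (1 + s)^-1 * alpha r) theta _ (tc 0)).
  have ar0 : 0 <= alpha r by exact: strict_gain_ge0.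
  apply/cvgrPdist_lt => e e0; near=> s.
  have s0 : 0 < s by near: s; apply: nbhs_pinfty_gt; exact: num_real.
  have se : alpha r / e < s by near: s; apply: nbhs_pinfty_gt; exact: num_real.
  rewrite sub0r normrN ger0_norm; last by rewrite mulr_ge0 // invr_ge0; lra.
  rewrite mulrC ltr_pdivrMr; last lra.
  by move: se; rewrite ltr_pdivrMr //; nra.
Unshelve. all: by end_near. Qed.

Lemma ISS_of_lyapunov : ISS (fun x d => F x + d).
Proof.
split; [by rewrite F0 addr0|exact: locally_lipschitzD|].
have [kappa kK Vk] := strict_gain_dominates_cV Vc V_pd.1 bc b_pd b_ru.
have [sigma sK sgs] := strict_gain_dominates_cV sgc sg0
  (@enorm_continuous R n) enorm_posdef enorm_unbounded.
have [chi cK chiV] := strict_gain_dominates_cV (@enorm_continuous R n) enorm0 Vc V_pd V_ru.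
have [alpha aK Va] := strict_gain_dominates_cV Vc V_pd.1
  (@enorm_continuous R n) enorm_posdef enorm_unbounded.
have K2 : strict_gain ( *%R (2 : R)) by exact: strict_gainZ.
(* [mu] gathers the two terms of [solution_bound] that carry the initial state. The outer factors 2
   in [theta] and [gamma] come from splitting [chi] of a sum. *)
pose mu s := kappa (2 * s) + s.
have muK : strict_gain mu by exact: strict_gainD (strict_gain_comp kK K2) strict_gain_id.
pose theta := chi \o ( *%R 2 \o mu).
have tK : strict_gain theta by exact: strict_gain_comp cK (strict_gain_comp K2 muK).
pose gamma := chi \o ( *%R 2 \o (kappa \o ( *%R 2 \o sigma))).
have gK : strict_gain gamma.
  exact: strict_gain_comp cK (strict_gain_comp K2
    (strict_gain_comp kK (strict_gain_comp K2 sK))).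
exists (fun r t => theta ((1 + t)^-1 * alpha r)), gamma; split.
- exact: class_KL_of_gain.
- exact: strict_gain_class_K.
move=> x0 v [vd _ _] vb; split; first exact: solution_exists.
move=> x sx t t0; set M := sup _.
have vM s : 0 <= s -> enorm (v s) <= M by exact: enorm_le_sup.
have M0 : 0 <= M by apply: le_trans (vM 0 (lexx _)); exact: enorm_ge0.
have c0 : 0 <= (1 + t)^-1 by rewrite invr_ge0; lra.
have Vxt := solution_bound kK Vk sK sgs vd vM sx t0.
apply: le_trans (chiV _) _; apply: le_trans (strict_gain_le cK Vxt) _.
rewrite -/(mu _); have V0 : 0 <= (1 + t)^-1 * V x0 by rewrite mulr_ge0.
apply: le_trans (strict_gain_add_le cK _ _) _.
- exact: strict_gain_ge0.
- by rewrite strict_gain_ge0 // mulr_ge0 // strict_gain_ge0.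
rewrite lerD2r; apply: (strict_gain_le tK); exact: ler_wpM2l.
Qed.

End LyapunovISS.

(** * The closed loop and its quadratic Lyapunov function *)

Lemma lipschitz_on_ballsX (R : realType) k (g : 'cV[R]_k -> R) j :
  lipschitz_on_balls g -> lipschitz_on_balls (fun x => g x ^+ j).
Proof.
move=> gL; elim: j => [|j IH].
  by under eq_fun do rewrite expr0; exact: lipschitz_on_balls_cst.
by under eq_fun do rewrite exprS; exact: lipschitz_on_ballsM.
Qed.

Lemma closed_loop_ISS (R : realType) (n m N M hN : nat)
    (W : 'M[mpolynomial R n]_(M, m)) (hZ : 'cV[mpolynomial R n]_hN)
    (H : 'M[mpolynomial R n]_(N, hN)) (Y : 'M[mpolynomial R n]_(m, hN))
    (P : 'M[R]_hN) (A : 'M[R]_(n, N)) (B : 'M[R]_(n, M))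
    (Abar : 'M[R]_(N + M)) (Bbar : 'M[R]_(N + M, n))
    (Xi Theta S_Theta : 'M[mpolynomial R n]_hN) (Gamma : 'M[{poly R}]_n)
    (eps eta : R) (lambda s_lambda : mpolynomial R (n + n))
    (S_partial : 'M[mpolynomial R (n + n)]_(hN + n + (N + M))) :
  (forall x, pmeval hZ x = 0 <-> x = 0) ->
  radially_unbounded (fun x => enorm (pmeval hZ x)) ->
  posdef Abar -> Ibar Abar Bbar A B -> 0 < eps -> posdef P -> 0 < eta ->
  sos s_lambda -> sos_mx S_Theta -> sos_mx S_partial ->
  (exists (nu : nat) (C : 'I_nu.+1 -> 'M[R]_n),
     forall r : R, map_mx (fun p : {poly R} => p.[r]) Gamma =
       \sum_(j < nu.+1) r ^+ (2 * j) *: C j) ->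
  (forall x d : 'cV[R]_n,
     peval lambda (col_mx x d) - eps = peval s_lambda (col_mx x d)) ->
  (forall x : 'cV[R]_n,
     pmeval Theta x - eta *: pmeval Xi x = pmeval S_Theta x) ->
  (forall x d : 'cV[R]_n,
     let L : 'M[R]_(N + M, hN) :=
       col_mx (pmeval H x *m P) (pmeval W x *m pmeval Y x) in
     let J : 'M[R]_(hN, n) := jacobian_mx (pmeval hZ) x in
     let lam : R := peval lambda (col_mx x d) in
     sym_block3
       (Tp (L^T *m - (invmx Abar *m Bbar) *m J^T) + pmeval Theta x
          + lam *: (J *m 1%:M *m J^T))
       J^T (- map_mx (fun p : {poly R} => p.[enorm d]) Gamma)
       L   0                                               (- (lam *: Abar))
     = - pmeval S_partial (col_mx x d)) ->
  positive_definite (fun x : 'cV[R]_n =>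
    qform (invmx P *m pmeval Xi x *m invmx P) (pmeval hZ x)) ->
  radially_unbounded (fun x : 'cV[R]_n =>
    qform (invmx P *m pmeval Xi x *m invmx P) (pmeval hZ x)) ->
  ISS (closed_loop W hZ H Y P A B).
Proof.
move=> hZ_eq0 hZ_ru pA AB eps0 pP eta0 sl_sos ST_sos Sp_sos [nu [C GammaE]] lamE ThE
  LMI b_pd b_ru.
have uP := posdef_unitmx pP.
have siP : (invmx P)^T = invmx P by rewrite trmx_inv pP.1.
pose b x := eta * qform (invmx P *m pmeval Xi x *m invmx P) (pmeval hZ x).
pose V x := qform (invmx P) (pmeval hZ x).
pose sg (d : 'cV[R]_n) := qform (map_mx (fun p : {poly R} => p.[enorm d]) Gamma) d.
have hZL := lipschitz_on_balls_mx_pmeval hZ.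
have iPL := @lipschitz_on_balls_mx_cst R n _ _ (invmx P).
have [K K0 hZV] := sqr_enorm_le_qform_inv pP.
apply: (@ISS_of_lyapunov R n (fun x => row_mx A B *m
    col_mx (pmeval H x *m pmeval hZ x)
           (pmeval W x *m pmeval Y x *m invmx P *m pmeval hZ x)) V b sg).
- apply: lipschitz_on_balls_mxM; first exact: lipschitz_on_balls_mx_cst.
  apply: lipschitz_on_balls_mx_col.
    by apply: lipschitz_on_balls_mxM => //; exact: lipschitz_on_balls_mx_pmeval.
  apply: lipschitz_on_balls_mxM => //; apply: lipschitz_on_balls_mxM => //.
  by apply: lipschitz_on_balls_mxM; exact: lipschitz_on_balls_mx_pmeval.
- by have /hZ_eq0 -> : (0 : 'cV[R]_n) = 0 by []; rewrite !mulmx0 col_mx0 mulmx0.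
- by apply: lipschitz_on_balls_continuous; exact: lipschitz_on_balls_qform.
- split=> [|x x0].
    by rewrite /V; have /hZ_eq0 -> : (0 : 'cV[R]_n) = 0 by []; rewrite /qform mulmx0 mxE.
  rewrite -(pmulr_rgt0 _ K0); apply: lt_le_trans (hZV _).
  rewrite exprn_gt0 // enorm_gt0 //; apply: contra x0 => /eqP /hZ_eq0 ->.
  exact: eqxx.
(* The threshold is at least 1 so that [|z| <= |z|^2]; then [K k < |z| <= |z|^2 <= K V]. *)
- move=> k; have [r hr] := hZ_ru (Num.max 1 (K * k)); exists r => x /hr.
  rewrite gt_max => /andP[z1 zk]; rewrite -(ltr_pM2l K0); apply: lt_le_trans (hZV _).
  apply: lt_le_trans zk _; rewrite expr2 -[leLHS]mul1r; apply: ler_wpM2r; last exact: ltW.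
  exact: enorm_ge0.
- apply: lipschitz_on_balls_continuous; apply: lipschitz_on_ballsM.
    exact: lipschitz_on_balls_cst.
  apply: lipschitz_on_balls_qform => //.
  apply: lipschitz_on_balls_mxM => //; apply: lipschitz_on_balls_mxM => //.
  exact: lipschitz_on_balls_mx_pmeval.
- case: b_pd => b0 bpos; split=> [|x /bpos bx]; first by rewrite /b b0 mulr0.
  exact: mulr_gt0.
- move=> k; have [r br] := b_ru (k / eta); exists r => x /br.
  by rewrite ltr_pdivrMr // mulrC.
(* Only even powers occur, so [sg] is a polynomial expression in [d], although the norm itself is
   not. *)
- have -> : sg = fun d => \sum_(j < nu.+1) (enorm d ^+ 2) ^+ j * qform (C j) d.
    apply/funext => d; rewrite /sg GammaE qformE bform_summ.
    by apply: eq_bigr => j _; rewrite bformZm exprM.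
  apply: lipschitz_on_balls_continuous; apply: lipschitz_on_balls_sum => j.
  apply: lipschitz_on_ballsM.
    by apply: lipschitz_on_ballsX; exact: lipschitz_on_balls_sqr_enorm.
  apply: lipschitz_on_balls_qform; last exact: lipschitz_on_balls_mx_id.
  exact: lipschitz_on_balls_mx_cst.
- by rewrite /sg /qform mulmx0 mxE.
move=> x t d dx.
exists (2 * bform (invmx P) (pmeval hZ (x t)) (jacobian_mx (pmeval hZ) (x t) *m
    (row_mx A B *m col_mx (pmeval H (x t) *m pmeval hZ (x t))
       (pmeval W (x t) *m pmeval Y (x t) *m invmx P *m pmeval hZ (x t)) + d))).
  exact: is_derive_qform siP (is_derive_pmeval hZ dx).
(* Since [P y = z], the closed-loop regressor is [L y]; [D] is the deviation of [[A B]^T] from the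
   centre [- Abar^-1 Bbar] of the ellipsoid. *)
set J := jacobian_mx _ _; set z := pmeval hZ (x t); pose y := invmx P *m z.
pose L := col_mx (pmeval H (x t) *m P) (pmeval W (x t) *m pmeval Y (x t)).
pose zeta : 'M[R]_(N + M, n) := (row_mx A B)^T.
pose D := zeta + invmx Abar *m Bbar.
have zy : P *m y = z by rewrite mulmxA mulmxV // mul1mx.
have -> : col_mx (pmeval H (x t) *m z) (pmeval W (x t) *m pmeval Y (x t) *m invmx P *m z)
    = L *m y.
  by rewrite mul_col_mx -[pmeval H _ *m P *m y]mulmxA zy /y !mulmxA.
have -> : row_mx A B = (- (invmx Abar *m Bbar) + D)^T.
  by rewrite /D addrC addrK /zeta trmxK.
rewrite -bform_mulr bform_mull siP -/y.
have lam0 : 0 <= peval lambda (col_mx (x t) d).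
  have := sos_ge0 (col_mx (x t) d) sl_sos; rewrite -lamE; lra.
have DA : loewner (D^T *m Abar *m D) 1%:M.
  by move: AB; rewrite /Ibar -/zeta completed_square.
apply: le_trans (dissipation_inequality (L := L) (Th := pmeval Theta (x t))
  (G := map_mx (fun p : {poly R} => p.[enorm d]) Gamma) y d lam0 DA _) _.
  move=> v; rewrite (LMI (x t) d).
  by rewrite qformE bformNm oppr_le0; exact: sos_mx_ge0.
rewrite lerD2r lerN2 /b.
have -> : qform (invmx P *m pmeval Xi (x t) *m invmx P) z = qform (pmeval Xi (x t)) y.
  by rewrite !qformE bform_mulr bform_mull siP.
have := sos_mx_ge0 (x t) y ST_sos; rewrite -ThE !qformE bformBm bformZm.
by rewrite subr_ge0.
Qed.


Theorem theorem4p6 (R : realType) (n m N M hN T : nat)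
    (Z : 'cV[mpolynomial R n]_N) (W : 'M[mpolynomial R n]_(M, m))
    (Z_monomial : forall i, is_monomial (Z i ord0))
    (W_monomial : forall i j, is_monomial (W i j))
    (Z0 : pmeval Z 0 = 0)
    (Astar : 'M[R]_(n, N)) (Bstar : 'M[R]_(n, M))
    (hZ : 'cV[mpolynomial R n]_hN) (H : 'M[mpolynomial R n]_(N, hN))
    (hZ_eq0 : forall x, pmeval hZ x = 0 <-> x = 0)
    (Z_factor : forall x, pmeval Z x = pmeval H x *m pmeval hZ x)
    (hZ_unbounded : radially_unbounded (fun x => enorm (pmeval hZ x)))
    (u_ : 'I_T -> 'cV[R]_m) (x_ xdot_ d_ : 'I_T -> 'cV[R]_n)
    (delta : R) (delta_gt0 : 0 < delta)
    (data_eq : forall i, xdot_ i =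
       Astar *m pmeval Z (x_ i) + Bstar *m (pmeval W (x_ i) *m u_ i) + d_ i)
    (data_noise : forall i, enorm (d_ i) ^+ 2 <= delta)
    (feasible : opt_feasible Z W u_ x_ xdot_ delta)
    (Abar : 'M[R]_(N + M)) (Bbar : 'M[R]_(N + M, n)) (tau : 'I_T -> R)
    (optimal : opt_solution Z W u_ x_ xdot_ delta Abar Bbar tau)
    (zetabar : 'M[R]_(N + M, n)) (zetabarE : zetabar = - (invmx Abar *m Bbar))
    (Qbar : 'M[R]_n) (QbarE : Qbar = 1%:M)
    (Xi : 'M[mpolynomial R n]_hN) (Xi_sym : Xi^T = Xi)
    (eps : R) (eps_gt0 : 0 < eps)
    (P : 'M[R]_hN) (P_posdef : posdef P)
    (Y : 'M[mpolynomial R n]_(m, hN)) (Gamma : 'M[{poly R}]_n)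
    (Theta : 'M[mpolynomial R n]_hN) (Theta_sym : Theta^T = Theta)
    (eta : R) (eta_gt0 : 0 < eta)
    (lambda s_lambda : mpolynomial R (n + n)) (s_lambda_sos : sos s_lambda)
    (S_Theta : 'M[mpolynomial R n]_hN) (S_Theta_sos : sos_mx S_Theta)
    (S_partial : 'M[mpolynomial R (n + n)]_(hN + n + (N + M)))
    (S_partial_sos : sos_mx S_partial)
    (cond_a : exists (nu : nat) (C : 'I_nu.+1 -> 'M[R]_n),
       [/\ forall j, possemidef (C j),
           loewner (eps%:M) (\sum_j C j)
         & forall r : R, map_mx (fun p : {poly R} => p.[r]) Gamma =
             \sum_(j < nu.+1) r ^+ (2 * j) *: C j])
    (cond_b : forall x d : 'cV[R]_n,
       peval lambda (col_mx x d) - eps = peval s_lambda (col_mx x d))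
    (cond_c : forall x : 'cV[R]_n,
       pmeval Theta x - eta *: pmeval Xi x = pmeval S_Theta x)
    (cond_d : forall x d : 'cV[R]_n,
       let L : 'M[R]_(N + M, hN) :=
         col_mx (pmeval H x *m P) (pmeval W x *m pmeval Y x) in
       let J : 'M[R]_(hN, n) := jacobian_mx (pmeval hZ) x in
       let lam : R := peval lambda (col_mx x d) in
       sym_block3
         (Tp (L^T *m zetabar *m J^T) + pmeval Theta x
            + lam *: (J *m Qbar *m J^T))
         J^T (- map_mx (fun p : {poly R} => p.[enorm d]) Gamma)
         L   0                                               (- (lam *: Abar))
       = - pmeval S_partial (col_mx x d))
    (b_posdef : positive_definite (fun x : 'cV[R]_n =>
       qform (invmx P *m pmeval Xi x *m invmx P) (pmeval hZ x)))
    (b_unbounded : radially_unbounded (fun x : 'cV[R]_n =>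
       qform (invmx P *m pmeval Xi x *m invmx P) (pmeval hZ x))) :
  (forall (A : 'M[R]_(n, N)) (B : 'M[R]_(n, M)),
     Ibar Abar Bbar A B -> ISS (closed_loop W hZ H Y P A B))
  /\ ISS (closed_loop W hZ H Y P Astar Bstar).
Proof.
have [[pA tau0 [_ LMI]] _] := optimal.
have iss A B : Ibar Abar Bbar A B -> ISS (closed_loop W hZ H Y P A B).
  move=> AB; have [nu [C [_ _ GammaE]]] := cond_a.
  apply: (closed_loop_ISS (Abar := Abar) (Bbar := Bbar) (Xi := Xi) (Theta := Theta)
    (S_Theta := S_Theta) (Gamma := Gamma) (eps := eps) (eta := eta) (lambda := lambda)
    (s_lambda := s_lambda) (S_partial := S_partial)) => //; first by exists nu, C.
  by move=> x d; have := cond_d x d; rewrite zetabarE QbarE.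
split=> //; apply: iss.
apply: (data_consistent (l := data_ell Z W u_ x_) (xdot := xdot_) _ data_noise tau0 pA _)
  => [i|v].
  by rewrite trmxK data_eq /data_ell mul_row_col.
by have := LMI v; rewrite sub0r qformE bformNm oppr_ge0.
Qed.
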